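(* Let a finite abelian group $A$ act faithfully and linearly on the free skew-field $\mathbb{R}(\!\langle x_1,\dots,x_n\rangle\!)$. Then the skew-field of invariants is rational: $$\mathbb{R}(\!\langle x_1,\dots,x_n\rangle\!)^{A}\cong \mathbb{R}(\!\langle w_1,\dots,w_{|A|(n-1)+1}\rangle\!)$$ as skew-fields over $\mathbb{R}$.
   Context: For a field $\mathbb{F}$, the free skew-field $\mathbb{F}(\!\langle x_1,\dots,x_n\rangle\!)$ (skew-field of noncommutative rational functions in $n$ variables) is the universal skew-field of fractions of the free associative algebra $\mathbb{F}\langle x_1,\dots,x_n\rangle$. A group $G$ acts linearly on $\mathbb{F}(\!\langle x_1,\dots,x_n\rangle\!)$ if the action (by $\mathbb{F}$-algebra automorphisms) is the one induced by a linear representation $G\to\mathrm{GL}(V)$, where $V=\mathrm{span}_{\mathbb{F}}\{x_1,\dots,x_n\}$. A superscript $G$ denotes the fixed sub-skew-field. *)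

(* Defs.v *)
From HB Require Import structures.
From mathcomp Require Import all_boot all_order all_algebra all_fingroup.
From mathcomp Require Import mxrepresentation.
From mathcomp Require Import reals.
From mathcomp.multinomials Require Import monalg.

Set Implicit Arguments.
Unset Strict Implicit.
Unset Printing Implicit Defensive.

Import GRing.Theory.
Local Open Scope ring_scope.

(* [unitRingType] is not assumed commutative, so this is a division ring
   (1 != 0 is part of [unitRingType]). *)
Definition skew_field (K : unitRingType) : Prop := GRing.field_axiom K.

(* Cohn's category of fields over a ring [T]: an epic [T]-field is a skew field
   [K] with a morphism [T -> K] whose image generates [K] as a skew field. *)
Section UniversalField.

Variable T : nzRingType.

Definition epic_field (K : unitRingType) (f : {rmorphism T -> K}) : Prop :=
  skew_field K /\
  (forall S : {pred K}, divring_closed S -> (forall r, f r \in S) ->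
     forall a, a \in S).

(* A specialization from [K] to [L] is a morphism of rings over [T] to [L],
   defined on a subring [S] of [K] containing the image of [T], such that the
   elements of [S] outside its kernel are invertible in [S].  The values of the
   total function [h] outside [S] are irrelevant. *)
Definition specialization (K L : unitRingType)
    (f : {rmorphism T -> K}) (g : {rmorphism T -> L}) : Prop :=
  exists (S : {pred K}) (h : K -> L),
    [/\ subring_closed S /\ (forall r, f r \in S),
        [/\ h 1 = 1, {in S &, {morph h : a b / a - b}}
          & {in S &, {morph h : a b / a * b}}],
        forall r, h (f r) = g r
      & {in S, forall a, h a != 0 -> a^-1 \in S}].

(* Uniqueness of the specialization (up to restriction to a smaller subring on
   which it is still a specialization) is automatic: two specializations agree
   on the subring of elements of both domains where they have the same value. *)
Definition universal_field_of_fractions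
    (K : unitRingType) (f : {rmorphism T -> K}) : Prop :=
  [/\ epic_field f, injective f
    & forall (L : unitRingType) (g : {rmorphism T -> L}),
        epic_field g -> specialization f g].

End UniversalField.

(* Algebra of the free monoid on [n] letters. *)
Definition free_algebra (F : fieldType) (n : nat) : lalgType F :=
  {malg F[{fmonom 'I_n}]}.

(* A model of F(<x_1, ..., x_n>); it is determined up to an isomorphism of
   F-algebras over the free algebra. *)
Record freeSkewField (F : fieldType) (n : nat) := FreeSkewField {
  free_skew_field_sort :> unitAlgType F;
  free_skew_field_incl :
    {lrmorphism free_algebra F n -> free_skew_field_sort};
  free_skew_field_universal :
    universal_field_of_fractions free_skew_field_incl
}.

Definition gen (F : fieldType) (n : nat) (U : freeSkewField F n) (i : 'I_n) : U :=
  free_skew_field_incl U << fmu i >>.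

Section Actions.

Variables (F : fieldType) (gT : finGroupType) (A : {group gT}).

(* Only the values of [act] on [A] matter; for g in [A], [act g] is bijective,
   with inverse [act g^-1]. *)
Definition algebra_action (U : unitAlgType F)
    (act : gT -> {lrmorphism U -> U}) : Prop :=
  act 1%g =1 id /\ {in A &, forall g h, act (g * h)%g =1 act g \o act h}.

Definition faithful_action (U : unitAlgType F)
    (act : gT -> {lrmorphism U -> U}) : Prop :=
  {in A, forall g, act g =1 id -> g = 1%g}.

(* The columns of [rho g] are the coordinates of the images of the variables,
   so that [rho] being a morphism matches a left action on their span. *)
Definition linear_action (n : nat) (U : freeSkewField F n)
    (act : gT -> {lrmorphism U -> U}) : Prop :=
  exists rho : mx_representation F A n,
    {in A, forall g, forall j, act g (gen U j) = \sum_i rho g i j *: gen U i}.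

Section Fixed.

Variables (U : unitAlgType F) (act : gT -> {lrmorphism U -> U}).

Definition fixed_pred : {pred U} := [pred a | [forall g in A, act g a == a]].

Lemma fixed_predP a :
  reflect {in A, forall g, act g a = a} (a \in fixed_pred).
Proof.
by apply: (iffP forall_inP) => H g gA; [apply/eqP/H | apply/eqP/H].
Qed.

Lemma fixed_divalg_closed : divalg_closed fixed_pred.
Proof.
split=> [|c a b /fixed_predP Ha /fixed_predP Hb|a b /fixed_predP Ha /fixed_predP Hb];
  apply/fixed_predP=> g gA.
- by rewrite rmorph1.
- by rewrite linearP /= Ha ?Hb.
- rewrite rmorphM /= Ha //; have [Ub|Ub] := boolP (b \is a GRing.unit).
    by rewrite rmorphV //= Hb.
  by rewrite (invr_out Ub) /= Hb.
Qed.

HB.instance Definition _ :=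
  GRing.isDivalgClosed.Build F U fixed_pred fixed_divalg_closed.

Definition fixed_field := {a : U | a \in fixed_pred}.

HB.instance Definition _ := SubChoice.on fixed_field.
HB.instance Definition _ :=
  [SubChoice_isSubUnitRing of fixed_field by <:].
HB.instance Definition _ := [SubZmodule_isSubLmodule of fixed_field by <:].
HB.instance Definition _ :=
  [SubNzRing_SubLmodule_isSubLalgebra of fixed_field by <:].
HB.instance Definition _ := [SubLalgebra_isSubAlgebra of fixed_field by <:].

End Fixed.

End Actions.

Definition alg_isomorphic (F : fieldType) (U V : unitAlgType F) : Prop :=
  exists phi : {lrmorphism U -> V}, bijective phi.

(* Main.v *)
(** Pick [l] in the span of the variables whose translates [l_b] are pairwise
    distinct.  The elements [p_b = (1 - l_b)^-1] are permuted by the group and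
    form a basis of [U] over the field [K] of invariants: evaluated at a suitable
    point, they give a permutation matrix.  In this basis the right multiplications by
    the variables are matrices over [K], and by equivariance and the relation
    [p_b - p_b l_b = 1] all their entries are affine functions of |A|(n-1)+1
    elements of [K].  Replacing these elements by the variables of [W] gives
    matrices [y] over [W], and the point is that [x |-> y] extends to a ring
    morphism from [U] to a matrix ring over [W].

    Elements of [U] are entries of inverses of linear pencils, so two facts are
    needed.  A pencil which is invertible at [x] is invertible at [y]: [W]
    specializes to [U] in such a way that [y] becomes conjugate to the diagonal
    matrices of the translates of [x].  And the rank of a pencil at a point made
    of N x N matrices is at most N times its rank over [U]: for N = 2^j, such a
    point can be moved, along lines in central parameters, into a division algebra
    of degree N over a field of Laurent series, to which [U] specializes; any N
    follows by filling large matrices with copies of the given ones.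

    The matrix of an invariant has constant column sums.  This sum is a morphism
    from [K] to [W], and it is onto because, up to conjugation, it sends the
    chosen elements of [K] to the variables of [W]. *)

Require Import Defs.
From HB Require Import structures.
From mathcomp Require Import all_boot all_order all_algebra all_fingroup.
From mathcomp Require Import mxrepresentation.
From mathcomp Require Import boolp zify.
From mathcomp Require Import reals.
From mathcomp.multinomials Require Import monalg.

Set Implicit Arguments.
Unset Strict Implicit.
Unset Printing Implicit Defensive.

Import GRing.Theory Num.Theory.
Local Open Scope ring_scope.

(** The number |A|(n-1)+1 comes from the relation p_b l_b = p_b - 1. It fixes right multiplication
    by l_b up to the coefficients of 1, which by equivariance are the same at all p_b: one
    parameter. Completing l by n-1 variables to a basis of their span leaves |A| coefficients for
    each of them.

    The obstacle is that the universal property only yields partial maps to skew fields, while y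
    lives in a matrix ring. The morphism is therefore built as a relation: an element of U and a
    matrix are related if one linear representation c Phi^-1 b computes both. Ring operations
    preserve this relation. Totality needs the first of the two facts on pencils, because inverting
    an element borders its pencil. Single-valuedness needs the second: if c Phi^-1 b = 0 over U, the
    bordered pencil has rank |K| there, where K indexes Phi, and a nonzero entry at y would produce
    an invertible minor of size N|K|+1.

    Injectivity on invariants is free, since they form a skew field; surjectivity is what has to be
    proved. *)

Lemma big_option (V : nmodType) (K : finType) (F : option K -> V) :
  \sum_o F o = F None + \sum_k F (Some k).
Proof.
rewrite (bigD1 None) //=; congr (_ + _).
rewrite (reindex_omap Some id) /=; last by case.
by apply: eq_bigl => k; rewrite eqxx.
Qed.

(** * Matrices over noncommutative rings, with finite types as index sets *)

Section MatRing.

Variable L : nzRingType.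
Implicit Types I J K : finType.

(** Matrices are functions on finite types, so that borders, blocks and Kronecker products get the
    index types [option K], [I + J] and [I * B] without arithmetic on ordinals. *)
Definition mulm I J K (A : I -> J -> L) (B : J -> K -> L) : I -> K -> L :=
  fun i k => \sum_j A i j * B j k.

Definition idm I : I -> I -> L := fun i j => (i == j)%:R.

Definition inverse_mat I J (A : I -> J -> L) (B : J -> I -> L) : Prop :=
  mulm A B = @idm I /\ mulm B A = @idm J.

Lemma matP I J (A B : I -> J -> L) : (forall i j, A i j = B i j) -> A = B.
Proof. by move=> AB; apply/funext=> i; apply/funext=> j. Qed.

Lemma mulmE I J K (A : I -> J -> L) (B : J -> K -> L) i k :
  mulm A B i k = \sum_j A i j * B j k.
Proof. by []. Qed.

Lemma mulmN I J K (A : I -> J -> L) (B : J -> K -> L) :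
  mulm A (fun i j => - B i j) = fun i j => - mulm A B i j.
Proof. by apply: matP => i k; rewrite /mulm -sumrN; apply: eq_bigr => j _; rewrite mulrN. Qed.

Lemma mulNm I J K (A : I -> J -> L) (B : J -> K -> L) :
  mulm (fun i j => - A i j) B = fun i j => - mulm A B i j.
Proof. by apply: matP => i k; rewrite /mulm -sumrN; apply: eq_bigr => j _; rewrite mulNr. Qed.

Lemma mulmA I J K (H : finType) (A : I -> J -> L) (B : J -> K -> L) (C : K -> H -> L) :
  mulm A (mulm B C) = mulm (mulm A B) C.
Proof.
apply: matP => i j; rewrite /mulm; under eq_bigr do rewrite mulr_sumr.
rewrite exchange_big /=; apply: eq_bigr => k _; rewrite mulr_suml.
by apply: eq_bigr => l _; rewrite mulrA.
Qed.

Lemma sum_idl I (F : I -> L) i : \sum_j (i == j)%:R * F j = F i.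
Proof.
rewrite (bigD1 i) //= eqxx mul1r big1 ?addr0 // => j /negPf ji.
by rewrite eq_sym ji mul0r.
Qed.

Lemma sum_idr I (F : I -> L) i : \sum_j F j * (j == i)%:R = F i.
Proof.
rewrite (bigD1 i) //= eqxx mulr1 big1 ?addr0 // => j /negPf ji.
by rewrite ji mulr0.
Qed.

Lemma mul1m I J (A : I -> J -> L) : mulm (@idm I) A = A.
Proof. by apply: matP => i j; rewrite /mulm /idm sum_idl. Qed.

Lemma mulm1 I J (A : I -> J -> L) : mulm A (@idm J) = A.
Proof. by apply: matP => i j; rewrite /mulm /idm sum_idr. Qed.

Lemma inverse_mat_inj I J K (A : I -> J -> L) A' (f : K -> I) (g : K -> J) :
  inverse_mat (fun k l => A (f k) (g l)) A' -> injective f /\ injective g.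
Proof.
move=> [AA' A'A]; split=> k l kl; apply/eqP.
  have: @idm K k l = @idm K l l by rewrite -AA' /mulm kl.
  by rewrite /idm eqxx; case: eqP => // _ /esym/eqP; rewrite oner_eq0.
have: @idm K l k = @idm K l l by rewrite -A'A /mulm kl.
by rewrite /idm eqxx eq_sym; case: eqP => // _ /esym/eqP; rewrite oner_eq0.
Qed.

(** The rows and the columns selected by an invertible minor are distinct, so a minor at least as
    large as the matrix is the whole matrix up to bijections. *)
Lemma inverse_mat_reindex I J K (A : I -> J -> L) A' (f : K -> I) (g : K -> J) :
  inverse_mat (fun k l => A (f k) (g l)) A' ->
  (#|I| <= #|K|)%N -> (#|J| <= #|K|)%N ->
  exists f' : I -> K, exists g' : J -> K,
    inverse_mat A (fun j i => A' (g' j) (f' i)).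
Proof.
move=> inv IK JK; have [injf injg] := inverse_mat_inj inv.
have [f' ff' f'f] := inj_card_bij injf IK.
have [g' gg' g'g] := inj_card_bij injg JK.
exists f', g'; case: inv => AA' A'A; split; apply: matP => i j.
  rewrite /mulm (reindex g) /=; last by exists g' => x _.
  have /(congr1 (fun M => M (f' i) (f' j))) := AA'.
  rewrite /mulm /idm (can_eq f'f) => <-; apply: eq_bigr => k _.
  by rewrite f'f gg'.
rewrite /mulm (reindex f) /=; last by exists f' => x _.
have /(congr1 (fun M => M (g' i) (g' j))) := A'A.
rewrite /mulm /idm (can_eq g'g) => <-; apply: eq_bigr => k _.
by rewrite g'g ff'.
Qed.

Section Border.

Variables (K : finType) (P N : K -> K -> L) (b c : K -> L) (d t : L).
Hypothesis PN : inverse_mat P N.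
Hypothesis ts : t * (d - \sum_k \sum_l c k * N k l * b l) = 1.
Hypothesis st : (d - \sum_k \sum_l c k * N k l * b l) * t = 1.

Definition border : option K -> option K -> L := fun i j =>
  match i, j with
  | Some k, Some l => P k l
  | Some k, None => b k
  | None, Some l => c l
  | None, None => d
  end.

Let Nb k := \sum_l N k l * b l.
Let cN l := \sum_k c k * N k l.

(** Block inversion through the Schur complement [d - c N b], of which [t] is the two-sided
    inverse. *)
Definition border_inv : option K -> option K -> L := fun i j =>
  match i, j with
  | Some k, Some l => N k l + Nb k * t * cN l
  | Some k, None => - (Nb k * t)
  | None, Some l => - (t * cN l)
  | None, None => t
  end.

Let cNb : \sum_k c k * Nb k = \sum_k \sum_l c k * N k l * b l.
Proof.
by apply: eq_bigr => k _; rewrite mulr_sumr; apply: eq_bigr => l _; rewrite mulrA.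
Qed.

Let cNb' : \sum_l cN l * b l = \sum_k \sum_l c k * N k l * b l.
Proof.
rewrite exchange_big /=; apply: eq_bigr => l _.
by rewrite mulr_suml.
Qed.

Let PNb k : \sum_l P k l * Nb l = b k.
Proof.
transitivity (\sum_l mulm P N k l * b l); last first.
  by rewrite PN.1 /idm sum_idl.
rewrite /mulm; under [RHS]eq_bigr do rewrite mulr_suml.
rewrite exchange_big /=; apply: eq_bigr => l _; rewrite mulr_sumr.
by apply: eq_bigr => m _; rewrite mulrA.
Qed.

Let cNP l : \sum_k cN k * P k l = c l.
Proof.
transitivity (\sum_k c k * mulm N P k l); last first.
  by rewrite PN.2 /idm sum_idr.
rewrite /mulm; under eq_bigr do rewrite mulr_suml.
rewrite exchange_big /=; apply: eq_bigr => k _; rewrite mulr_sumr.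
by apply: eq_bigr => m _; rewrite mulrA.
Qed.

Lemma border_inverse : inverse_mat border border_inv.
Proof.
have PN1 k l : \sum_m P k m * N m l = (k == l)%:R.
  by have /(congr1 (fun M => M k l)) := PN.1.
have NP1 k l : \sum_m N k m * P m l = (k == l)%:R.
  by have /(congr1 (fun M => M k l)) := PN.2.
split; apply: matP => -[k|] [l|]; rewrite /mulm /idm big_option /=.
- under eq_bigr do rewrite mulrDr !mulrA.
  rewrite big_split /= PN1 -!mulr_suml PNb mulrN mulrA.
  by rewrite addrCA addNr addr0; congr (_%:R).
- under eq_bigr do rewrite mulrN mulrA.
  by rewrite sumrN -mulr_suml PNb subrr.
- under eq_bigr do rewrite mulrDr !mulrA.
  rewrite big_split /= -/(cN l) -!mulr_suml cNb mulrN mulrA.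
  rewrite -[X in _ + (X + _)]mul1r -{1}st !mulrBl.
  by rewrite subrK addrC subrr.
- under eq_bigr do rewrite mulrN mulrA.
  by rewrite sumrN -mulr_suml cNb -mulrBl st.
- rewrite mulNr; under eq_bigr do rewrite mulrDl -!mulrA.
  rewrite big_split /= NP1 -!mulr_sumr cNP mulrA addrCA addNr addr0.
  by congr (_%:R).
- under eq_bigr do rewrite mulrDl -[X in _ + X]mulrA.
  rewrite big_split /= -/(Nb k) -mulr_sumr cNb' mulNr.
  rewrite -[X in _ + (X + _)]mulr1 -{1}ts -!mulrA !mulrBr.
  by rewrite subrK addrC subrr.
- under eq_bigr do rewrite mulNr -mulrA.
  by rewrite sumrN -mulr_sumr cNP subrr.
- under eq_bigr do rewrite mulNr -mulrA.
  by rewrite sumrN -mulr_sumr cNb' -mulrBr ts.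
Qed.

End Border.

End MatRing.

(** * Matrices over skew fields *)

Section SkewLinear.

Variable L : unitRingType.
Hypothesis skewL : GRing.field_axiom L.
Implicit Types I J K : finType.

(** Gaussian elimination, by induction on the number of equations; [X] holds the unknowns not yet
    used as pivots. *)
Lemma kernel_set I n (C : nat -> I -> L) (X : {set I}) : (n < #|X|)%N ->
  exists v : I -> L, [/\ exists i, v i != 0, forall i, i \notin X -> v i = 0
    & forall j, (j < n)%N -> \sum_i C j i * v i = 0].
Proof.
elim: n C X => [|n IHn] C X ltnX.
  have [i Xi] : exists i, i \in X by apply/set0Pn; rewrite -card_gt0.
  exists (fun j => (j == i)%:R); split=> //; first by exists i; rewrite eqxx oner_eq0.
  by move=> j; case: eqP => // ->; rewrite Xi.
have [[i0 [Xi0 Ci0]]|C0] := pselect (exists i, i \in X /\ C n i != 0); last first.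
  have [|v [v_neq0 v0 Cv]] := IHn C X; first exact: ltnW.
  exists v; split=> // j; rewrite ltnS leq_eqVlt => /predU1P[->|/Cv//].
  apply: big1 => i _; have [Xi|/v0 ->] := boolP (i \in X); last by rewrite mulr0.
  suff /eqP -> : C n i == 0 by rewrite mul0r.
  by apply: contra_notT C0 => Cni; exists i.
have UC := skewL Ci0; pose q := (C n i0)^-1.
(* Left multiples of equation [n] remove the unknown [i0] from the other equations; [- t] is then
   the value of this unknown that solves equation [n]. *)
have [|v [[i1 v_neq0] v0 Cv]] := IHn (fun j i => C j i - C j i0 * q * C n i) (X :\ i0).
  by move: ltnX; rewrite (cardsD1 i0) Xi0.
pose t := q * \sum_k C n k * v k.
have vi0 : v i0 = 0 by apply: v0; rewrite !inE eqxx.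
have sumE j : \sum_i C j i * (v i - (i == i0)%:R * t) = \sum_i C j i * v i - C j i0 * t.
  under eq_bigr do rewrite mulrBr mulrA.
  by rewrite sumrB -mulr_suml sum_idr.
exists (fun i => v i - (i == i0)%:R * t); split=> [|i Xi|j].
- exists i1; have [i10|_] := eqVneq i1 i0; last by rewrite mul0r subr0.
  by rewrite i10 vi0 eqxx in v_neq0.
- rewrite v0 ?inE ?negb_and ?Xi ?orbT //; have [i_i0|_] := eqVneq i i0.
    by rewrite i_i0 Xi0 in Xi.
  by rewrite mul0r subr0.
rewrite ltnS leq_eqVlt sumE => /predU1P[->|ltjn].
  by rewrite /t mulrA divrr // mul1r subrr.
rewrite -[RHS](Cv j ltjn) /t !mulrA mulr_sumr -sumrB.
rewrite /=. apply: eq_bigr => i _. by rewrite mulrBl !mulrA.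
Qed.

Lemma kernel_vector I J (C : J -> I -> L) : (#|J| < #|I|)%N ->
  exists v : I -> L, (exists i, v i != 0) /\ forall j, \sum_i C j i * v i = 0.
Proof.
move=> ltJI; have ltJX : (#|J| < #|[set: I]|)%N by rewrite cardsT.
have [v [v_neq0 _ Cv]] := kernel_set
  (fun j i => oapp (fun k : 'I_#|J| => C (enum_val k) i) 0 (insub j)) ltJX.
exists v; split=> // j; have := Cv (enum_rank j) (ltn_ord _).
by rewrite valK /= enum_rankK.
Qed.

(** A nonzero vector killed by [C] would be killed by the identity. *)
Lemma id_factor_card I J (B : I -> J -> L) (C : J -> I -> L) :
  mulm B C = @idm L I -> (#|I| <= #|J|)%N.
Proof.
move=> BC; rewrite leqNgt; apply/negP => /(@kernel_vector _ _ C)[v [[i v_i] Cv]].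
suff v0 : v i = 0 by rewrite v0 eqxx in v_i.
have : \sum_j (mulm B C) i j * v j = 0.
  rewrite /mulm; under eq_bigr do rewrite mulr_suml.
  rewrite exchange_big big1 //= => k _.
  under eq_bigr do rewrite -mulrA.
  by rewrite -mulr_sumr Cv mulr0.
by rewrite BC /idm sum_idl.
Qed.

(** The identity of size [K] factors through [H] too. Upper bounds on ranks are obtained in this
    way, from factorizations. *)
Lemma minor_card I J K (H : finType) (A : I -> J -> L) (B : I -> H -> L) (C : H -> J -> L)
    (f : K -> I) (g : K -> J) N :
  A = mulm B C -> inverse_mat (fun k l => A (f k) (g l)) N -> (#|K| <= #|H|)%N.
Proof.
move=> -> [BCN _]; apply: (@id_factor_card _ _ (fun k => B (f k))
  (mulm (fun h l => C h (g l)) N)).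
by rewrite mulmA -BCN.
Qed.

Section Subring.

Variable S : {pred L}.
Hypothesis S_subring : subring_closed S.

Let S1 : 1 \in S. Proof. by case: S_subring. Qed.
Let SB : {in S &, forall a b, a - b \in S}. Proof. by case: S_subring. Qed.
Let SM : {in S &, forall a b, a * b \in S}. Proof. by case: S_subring. Qed.
Let S0 : 0 \in S. Proof. by rewrite -(subrr 1) SB. Qed.
Let SN a : a \in S -> - a \in S. Proof. by move=> Sa; rewrite -sub0r SB. Qed.
Let SD : {in S &, forall a b, a + b \in S}.
Proof. by move=> a b Sa Sb; rewrite -[b]opprK SB ?SN. Qed.
Let Ssum (I : finType) (F : I -> L) : (forall i, F i \in S) -> \sum_i F i \in S.
Proof. by move=> SF; elim/big_ind: _. Qed.

(** Greedy choice: while some Schur complement has an inverse in [S], bordering the minor by its row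
    and column keeps the inverse of the minor over [S]. Maximality refers to inverses over [S], not
    over [L]. *)
Lemma max_minor I J (M : I -> J -> L) : (forall i j, M i j \in S) ->
  exists K, exists f : K -> I, exists g : K -> J, exists N : K -> K -> L,
    [/\ inverse_mat (fun k l => M (f k) (g l)) N, forall k l, N k l \in S
      & forall i j t, let s := M i j - \sum_k \sum_l M i (g k) * N k l * M (f l) j in
          t * s = 1 -> s * t = 1 -> t \notin S].
Proof.
move=> SM_; suff ext m (K : finType) (f : K -> I) (g : K -> J) (N : K -> K -> L) :
    inverse_mat (fun k l => M (f k) (g l)) N -> (forall k l, N k l \in S) ->
    (#|I| <= #|K| + m)%N ->
  exists K, exists f : K -> I, exists g : K -> J, exists N : K -> K -> L,
    [/\ inverse_mat (fun k l => M (f k) (g l)) N, forall k l, N k l \in S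
      & forall i j t, let s := M i j - \sum_k \sum_l M i (g k) * N k l * M (f l) j in
          t * s = 1 -> s * t = 1 -> t \notin S].
  (* The search starts from the empty minor; [m] bounds the number of rows still available. *)
  apply: (ext #|I| void (of_void _) (of_void _) (fun k _ => of_void _ k)).
  - by split; apply: matP => -[].
  - by case.
  - by rewrite card_void.
elim: m K f g N => [|m IHm] K f g N PN SN_ leIK.
  (* No row is left: one more border would give an invertible minor with more than [#|I|] rows. *)
  exists K, f, g, N; split=> // i j t s ts st.
  have PN' := border_inverse PN ts st; exfalso.
  have /minor_card : M = mulm (@idm L I) M by rewrite mul1m.
  pose f' o := if o is Some k then f k else i.
  pose g' o := if o is Some k then g k else j.
  have EM : border (fun k l => M (f k) (g l)) (fun k => M (f k) j)
     (fun l => M i (g l)) (M i j) = fun k l => M (f' k) (g' l).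
    by apply: matP => -[k|] [l|].
  rewrite EM in PN'; move/(_ _ _ _ _ PN').
  by rewrite card_option leqNgt ltnS -(addn0 #|K|) leIK.
have [[i [j [t [St ts st]]]]|max] := pselect (exists i j t,
    let s := M i j - \sum_k \sum_l M i (g k) * N k l * M (f l) j in
    [/\ t \in S, t * s = 1 & s * t = 1]); last first.
  exists K, f, g, N; split=> // i j t s ts st.
  by apply: contra_notN max => St; exists i, j, t.
have PN' := border_inverse PN ts st.
pose f' o := if o is Some k then f k else i.
pose g' o := if o is Some k then g k else j.
have EM : border (fun k l => M (f k) (g l)) (fun k => M (f k) j)
   (fun l => M i (g l)) (M i j) = fun k l => M (f' k) (g' l).
  by apply: matP => -[k|] [l|].
rewrite EM in PN'; apply: IHm PN' _ _; last by rewrite card_option addSnnS.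
have SNb k : \sum_l N k l * M (f l) j \in S by apply: Ssum => l; apply: SM.
have ScN l : \sum_k M i (g k) * N k l \in S by apply: Ssum => k; apply: SM.
by case=> [k|] [l|] //=; [apply: SD => //; apply: SM => //; apply: SM
  | apply: SN; apply: SM | apply: SN; apply: SM].
Qed.

End Subring.

(** With [S] the whole skew field, the Schur complements of a maximal minor have no inverse, hence
    vanish, and their vanishing is the factorization. *)
Lemma rank_factor I J (M : I -> J -> L) :
  exists K, exists f : K -> I, exists g : K -> J, exists N : K -> K -> L,
    inverse_mat (fun k l => M (f k) (g l)) N /\
    M = mulm (fun i l => \sum_k M i (g k) * N k l) (fun l j => M (f l) j).
Proof.
have [] := @max_minor predT _ I J M; [by split|by []|].
move=> K [f [g [N [PN _ max]]]]; exists K, f, g, N; split=> //.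
apply: matP => i j; apply/eqP; rewrite -subr_eq0 /mulm; apply/negPn/negP.
under eq_bigr do rewrite mulr_suml.
rewrite exchange_big /= => /skewL Us.
by have := max i j _ (mulVr Us) (mulrV Us).
Qed.

(** Either a maximal minor is as large as the matrix, or the matrix factors through fewer indices
    than it has columns. *)
Lemma singular_kernel I (M : I -> I -> L) : (exists N, inverse_mat M N) \/
  exists v : I -> L, (exists i, v i != 0) /\ forall i, \sum_j M i j * v j = 0.
Proof.
have [K [f [g [N [PN E]]]]] := rank_factor M.
have [leIK|ltKI] := leqP #|I| #|K|.
  by left; have [f' [g' inv]] := inverse_mat_reindex PN leIK leIK; eexists; exact: inv.
right; have [v [v_neq0 Cv]] := kernel_vector (fun l j => M (f l) j) ltKI.
exists v; split=> // i; rewrite E /mulm.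
under eq_bigr do rewrite mulr_suml.
rewrite exchange_big big1 //= => k _.
under eq_bigr do rewrite -mulrA.
by rewrite -mulr_sumr Cv mulr0.
Qed.

End SkewLinear.

Lemma subring_morph_sum (L L' : nzRingType) (S : {pred L}) (h : L -> L') :
  subring_closed S -> {in S &, {morph h : a b / a - b}} ->
  forall (J : finType) (f : J -> L), (forall i, f i \in S) ->
    \sum_i f i \in S /\ h (\sum_i f i) = \sum_i h (f i).
Proof.
move=> [S1 SB SM] hB J f Sf; have S0 : 0 \in S by rewrite -(subrr 1) SB.
have h0 : h 0 = 0 by rewrite -(subrr 1) hB ?subrr.
apply: (big_rec2 (fun x y => x \in S /\ h x = y)) => // i x y _ [Sx <-].
have [SNx hNx] : - x \in S /\ h (- x) = - h x by rewrite -sub0r SB // hB // h0 sub0r.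
have -> : f i + x = f i - - x by rewrite opprK.
by rewrite SB // hB // hNx opprK.
Qed.

(* [S] behaves as a local ring with residue map [h]. *)
Lemma local_inverse (L L' : unitRingType) (S : {pred L}) (h : L -> L')
    (I : finType) (M : I -> I -> L) (N' : I -> I -> L') :
  GRing.field_axiom L -> GRing.field_axiom L' -> subring_closed S ->
  {in S &, {morph h : a b / a - b}} -> {in S &, {morph h : a b / a * b}} ->
  {in S, forall a, h a != 0 -> a^-1 \in S} -> (forall i j, M i j \in S) ->
  inverse_mat (fun i j => h (M i j)) N' -> exists N, inverse_mat M N.
Proof.
move=> skewL skewL' Ssub hB hM hV SMij hMN.
have [S1 SB SM] := Ssub.
have h0 : h 0 = 0 by rewrite -(subrr 1) hB ?subrr.
have Ssum := subring_morph_sum Ssub hB.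
have [K [f [g [N [PN SN max]]]]] := max_minor skewL Ssub SMij.
(* A Schur complement with nonzero residue would be inverted in [S], against maximality. Hence the
   residue of [M] factors through [K], and its invertibility forces [K] to be as large as [I]. *)
have leIK : (#|I| <= #|K|)%N.
  apply: (@minor_card _ skewL' I I I K (fun i j => h (M i j))
     (fun i l => \sum_k h (M i (g k)) * h (N k l)) (fun l j => h (M (f l) j))
     id id N'); last exact: hMN.
  apply: matP => i j; rewrite /mulm; under eq_bigr do rewrite mulr_suml.
  rewrite exchange_big /=.
  have SE k : \sum_l M i (g k) * N k l * M (f l) j \in S /\
      h (\sum_l M i (g k) * N k l * M (f l) j) =
      \sum_l h (M i (g k)) * h (N k l) * h (M (f l) j).
    have [|S1' ->] := Ssum _ (fun l => M i (g k) * N k l * M (f l) j).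
      by move=> l; rewrite !SM.
    by split=> //; apply: eq_bigr => l _; rewrite !hM ?SM.
  have [|SS hS] := Ssum _ (fun k => \sum_l M i (g k) * N k l * M (f l) j).
    by move=> k; case: (SE k).
  under eq_bigr do rewrite -(SE _).2.
  rewrite -hS; apply/eqP; rewrite -subr_eq0 -hB //; apply/negPn/negP => hs.
  have Us : M i j - \sum_k \sum_l M i (g k) * N k l * M (f l) j \is a GRing.unit.
    by apply: skewL; apply: contraNneq hs => ->; rewrite h0.
  have := max i j _ (mulVr Us) (mulrV Us).
  by rewrite hV ?SB.
by have [f' [g' inv]] := inverse_mat_reindex PN leIK leIK; eexists; exact: inv.
Qed.

(** * Matrices that depend linearly on a central parameter *)

Definition central (L : nzRingType) (z : L) : Prop := forall x, z * x = x * z.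

Lemma centralB (L : nzRingType) (a b : L) : central a -> central b -> central (a - b).
Proof. by move=> Ca Cb x; rewrite mulrBl mulrBr Ca Cb. Qed.

Lemma centralM (L : nzRingType) (a b : L) : central a -> central b -> central (a * b).
Proof. by move=> Ca Cb x; rewrite -mulrA Cb mulrA Ca mulrA. Qed.

Lemma centralN (L : nzRingType) (a : L) : central a -> central (- a).
Proof. by move=> Ca x; rewrite mulNr mulrN Ca. Qed.

Lemma centralV (L : unitRingType) (a : L) : central a -> central a^-1.
Proof. by move=> Ca x; apply/esym/commrV/esym/Ca. Qed.

Section Pencil.

Variable L : unitRingType.
Hypothesis skewL : GRing.field_axiom L.

Lemma eigenvectors_free (I T : finType) (A : I -> I -> L) (v : T -> I -> L)
    (nu : T -> L) (a : T -> L) :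
  injective nu -> (forall t, central (nu t)) ->
  (forall t, exists i, v t i != 0) ->
  (forall t i, \sum_j A i j * v t j = nu t * v t i) ->
  (forall i, \sum_t v t i * a t = 0) -> forall t, a t = 0.
Proof.
move=> nu_inj nuC v_neq0 Av va t.
suff: forall n (X : {set T}) (b : T -> L), (#|X| <= n)%N ->
    (forall i, \sum_(s in X) v s i * b s = 0) -> forall s, s \in X -> b s = 0.
  move/(_ _ [set: T] a (leqnn _)) => -> // i; rewrite -[RHS](va i).
  by apply: eq_bigl => s; rewrite inE.
elim=> [|n IHn] X b leXn vb s Xs.
  by move: leXn; rewrite leqNgt card_gt0; case/negP; apply/set0Pn; exists s.
have b0 r : r \in X -> r != s -> b r = 0.
  (* Applying [A - nu s] to the relation removes the term [s] and multiplies the coefficient of [r]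
     by [nu r - nu s]. *)
  move=> Xr rs; have : (nu r - nu s) * b r = 0.
    apply: (IHn (X :\ s) (fun r => (nu r - nu s) * b r)) => [|i|]; last by rewrite !inE rs.
      by move: leXn; rewrite (cardsD1 s X) Xs.
    have : \sum_j A i j * (\sum_(r in X) v r j * b r) - nu s * (\sum_(r in X) v r i * b r) = 0.
      by under eq_bigr do rewrite vb mulr0; rewrite vb mulr0 subr0 big1.
    under eq_bigr do rewrite mulr_sumr.
    rewrite exchange_big mulr_sumr -sumrB (bigD1 s) //=.
    under eq_bigr do rewrite mulrA.
    rewrite -mulr_suml Av mulrA subrr add0r => Ev.
    rewrite -[RHS]Ev; apply: eq_big => [q|q _]; first by rewrite !inE andbC.
    under eq_bigr do rewrite mulrA.
    by rewrite -mulr_suml Av !mulrA -mulrBl -mulrBl (centralB (nuC q) (nuC s)).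
  have /skewL Urs : nu r - nu s != 0 by rewrite subr_eq0 (inj_eq nu_inj).
  by move/(congr1 ( *%R (nu r - nu s)^-1)); rewrite mulrA mulVr // mul1r mulr0.
have [i /skewL Uv] := v_neq0 s; have := vb i; rewrite (bigD1 s) //= big1.
  by rewrite addr0 => /(congr1 ( *%R (v s i)^-1)); rewrite mulrA mulVr // mul1r mulr0.
by move=> r /andP[Xr rs]; rewrite b0 ?mulr0.
Qed.

(** Replaces the finiteness of the roots of a determinant. If the matrix at [z t] is singular, a
    kernel vector is an eigenvector of [A], that is [N0 M1], for the eigenvalue [- (z t - z0)^-1];
    at most [#|I|] distinct central eigenvalues are possible. *)
Lemma pencil_generic (I T : finType) (M0 M1 : I -> I -> L) (z0 : L) N0 (z : T -> L) :
  (#|I| < #|T|)%N -> central z0 -> (forall t, central (z t)) -> injective z ->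
  inverse_mat (fun i j => M0 i j + z0 * M1 i j) N0 ->
  exists t, exists N, inverse_mat (fun i j => M0 i j + z t * M1 i j) N.
Proof.
move=> ltIT z0C zC z_inj [_ N0M].
apply: contrapT => singM.
have kerM t : exists v : I -> L, (exists i, v i != 0) /\
    forall i, \sum_j (M0 i j + z t * M1 i j) * v j = 0.
  have [[N NM]|//] := singular_kernel skewL (fun i j => M0 i j + z t * M1 i j).
  by case: singM; exists t, N.
have [v /all_and2[v_neq0 Mv]] := choice kerM.
pose A i j := \sum_k N0 i k * M1 k j.
pose mu t := z t - z0.
have muC t : central (mu t) by apply: centralB.
have vE t i : v t i = - (mu t * \sum_j A i j * v t j).
  have : \sum_k N0 i k * (\sum_j (M0 k j + z t * M1 k j) * v t j) = 0.
    by under eq_bigr do rewrite Mv mulr0; rewrite big1.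
  have ME k j : (M0 k j + z t * M1 k j) * v t j =
      (M0 k j + z0 * M1 k j) * v t j + mu t * M1 k j * v t j.
    by rewrite -mulrDl /mu mulrBl -addrA [z0 * _ + _]addrC subrK.
  under eq_bigr do under eq_bigr do rewrite ME.
  under eq_bigr do rewrite big_split mulrDr /=.
  rewrite big_split /= => /eqP; rewrite addr_eq0 => /eqP E.
  transitivity (\sum_j mulm N0 (fun i j => M0 i j + z0 * M1 i j) i j * v t j).
    by rewrite N0M /idm sum_idl.
  rewrite /mulm; under [LHS]eq_bigr do rewrite mulr_suml.
  rewrite [LHS]exchange_big /=.
  under [LHS]eq_bigr do under eq_bigr do rewrite -mulrA.
  under [LHS]eq_bigr do rewrite -mulr_sumr.
  rewrite E; congr (- _); rewrite mulr_sumr.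
  under [RHS]eq_bigr do rewrite /A mulr_suml mulr_sumr.
  rewrite exchange_big /=; apply: eq_bigr => k _; rewrite mulr_sumr.
  by apply: eq_bigr => j _; rewrite !mulrA (muC t (N0 i k)).
have mu_neq0 t : mu t != 0.
  by have [i] := v_neq0 t; apply: contraNneq => mu0; rewrite vE mu0 mul0r oppr0.
have Umu t := skewL (mu_neq0 t).
have [a [[t at0] va]] := kernel_vector skewL (fun i t => v t i) ltIT.
suff a0 : a t = 0 by rewrite a0 eqxx in at0.
apply: (@eigenvectors_free _ _ A v (fun t => - (mu t)^-1) a) => // [s r /oppr_inj /invr_inj|s|s i].
- by move/addIr/z_inj.
- exact/centralN/centralV.
- by rewrite [v s i]vE mulrN mulNr opprK mulrA mulVr ?mul1r.
Qed.

End Pencil.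

(** * Laurent series over a skew field *)

Section ClassicalInverse.

Variable K : nzRingType.

Definition is_inverse (x y : K) : Prop := y * x = 1 /\ x * y = 1.
Definition classical_unit : pred K := fun x => `[< exists y, is_inverse x y >].
(** Inverses are chosen classically, which makes any ring a unit ring; on nonunits the function is
    the identity, as that structure demands. *)
Definition classical_inv (x : K) : K :=
  if pselect (exists y, is_inverse x y) is left xP then sval (cid xP) else x.

Lemma classical_invP x : classical_unit x -> is_inverse x (classical_inv x).
Proof.
move=> /asboolP ux; rewrite /classical_inv; case: pselect => // xP.
exact: svalP (cid xP).
Qed.

Lemma classical_mulVr : {in classical_unit, left_inverse 1 classical_inv *%R}.
Proof. by move=> x /classical_invP[]. Qed.

Lemma classical_mulrV : {in classical_unit, right_inverse 1 classical_inv *%R}.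
Proof. by move=> x /classical_invP[]. Qed.

Lemma classical_unitP x y : y * x = 1 /\ x * y = 1 -> classical_unit x.
Proof. by move=> xy; apply/asboolP; exists y. Qed.

Lemma classical_inv_out : {in [predC classical_unit], classical_inv =1 id}.
Proof.
move=> x; rewrite inE => /asboolP nux; rewrite /classical_inv.
by case: pselect.
Qed.

End ClassicalInverse.

Lemma right_inverse_skew (K : unitRingType) :
  (forall x : K, x != 0 -> exists y, x * y = 1) -> GRing.field_axiom K.
Proof.
move=> rinv x /[dup] x0 /rinv[y xy]; apply/unitrP; exists y; split=> //.
have /rinv[z yz] : y != 0.
  by apply/eqP => y0; move/eqP: xy; rewrite y0 mulr0 eq_sym oner_eq0.
have E : z = x by rewrite -[z]mul1r -xy -mulrA yz mulr1.
by rewrite -E.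
Qed.

Section PowerSeries.

Variable F : nzRingType.

Definition powser := nat -> F.
HB.instance Definition _ := gen_eqMixin powser.
HB.instance Definition _ := gen_choiceMixin powser.

Implicit Types u v w : powser.

Lemma powser_addrA : associative (fun u v : powser => (fun n => u n + v n) : powser).
Proof. by move=> u v w; apply/funext=> n; rewrite addrA. Qed.
Lemma powser_addrC : commutative (fun u v : powser => (fun n => u n + v n) : powser).
Proof. by move=> u v; apply/funext=> n; rewrite addrC. Qed.
Lemma powser_add0r : left_id ((fun=> 0) : powser)
  (fun u v : powser => (fun n => u n + v n) : powser).
Proof. by move=> u; apply/funext=> n; rewrite add0r. Qed.
Lemma powser_addNr : left_inverse ((fun=> 0) : powser) (fun u => (fun n => - u n) : powser)
  (fun u v : powser => (fun n => u n + v n) : powser).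
Proof. by move=> u; apply/funext=> n; rewrite addNr. Qed.

HB.instance Definition _ := GRing.isZmodule.Build powser
  powser_addrA powser_addrC powser_add0r powser_addNr.

Definition cauchy u v : powser := fun n => \sum_(i < n.+1) u i * v (n - i)%N.

(** Reduces the associativity of the product to polynomials: coefficient [n] of a product only
    depends on truncations beyond [n]. *)
Definition trunc n u : {poly F} := \poly_(i < n) u i.

Lemma trunc_mul u v N n : (n < N)%N -> (trunc N u * trunc N v)`_n = cauchy u v n.
Proof.
move=> ltnN; rewrite coefM; apply: eq_bigr => i _; rewrite !coef_poly.
by rewrite (leq_trans (ltn_ord i) ltnN) (leq_ltn_trans (leq_subr _ _) ltnN).
Qed.

Lemma cauchyA : associative cauchy.
Proof.
move=> u v w; apply/funext=> n.
transitivity ((trunc n.+1 u * (trunc n.+1 v * trunc n.+1 w))`_n).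
  rewrite coefM; apply: eq_bigr => i _; rewrite coef_poly ltn_ord.
  by rewrite trunc_mul // ltnS leq_subr.
rewrite mulrA coefM; apply: eq_bigr => i _; rewrite trunc_mul //.
by rewrite coef_poly ltnS leq_subr.
Qed.

Definition mono k (c : F) : powser := fun n => if n == k then c else 0.

Lemma cauchy_monol k c u n : cauchy (mono k c) u n = if (n < k)%N then 0 else c * u (n - k)%N.
Proof.
rewrite /cauchy /mono; case: ltnP => [ltnk|lekn].
  by apply: big1 => i _; rewrite ltn_eqF /= ?mul0r // (leq_trans (ltn_ord i)).
rewrite (bigD1 (inord k)) //= inordK // eqxx big1 ?addr0 // => i.
have [ik|_ _] := eqVneq (i : nat) k; last by rewrite mul0r.
by case/negP; apply/eqP/val_inj; rewrite /= inordK.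
Qed.

Lemma cauchy_monor k c u n : cauchy u (mono k c) n = if (n < k)%N then 0 else u (n - k)%N * c.
Proof.
rewrite /cauchy /mono; case: ltnP => [ltnk|lekn].
  apply: big1 => i _; rewrite ltn_eqF /= ?mulr0 //.
  exact: leq_ltn_trans (leq_subr _ _) ltnk.
rewrite (bigD1 (inord (n - k))) //= inordK ?ltnS ?leq_subr // subKn // eqxx.
rewrite big1 ?addr0 // => i.
have [ik|_ _] := eqVneq (n - i)%N k; last by rewrite mulr0.
case/negP; apply/eqP/val_inj; rewrite /= inordK ?ltnS ?leq_subr //.
by rewrite -ik subKn // -ltnS.
Qed.

Lemma cauchy1r : left_id (mono 0 1) cauchy.
Proof. by move=> u; apply/funext=> n; rewrite cauchy_monol ltn0 subn0 mul1r. Qed.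
Lemma cauchyr1 : right_id (mono 0 1) cauchy.
Proof. by move=> u; apply/funext=> n; rewrite cauchy_monor ltn0 subn0 mulr1. Qed.
Lemma cauchyDl : left_distributive cauchy +%R.
Proof.
move=> u v w; apply/funext=> n.
rewrite -[RHS]/(cauchy u w n + cauchy v w n) -big_split.
by apply: eq_bigr => i _; exact: mulrDl.
Qed.
Lemma cauchyDr : right_distributive cauchy +%R.
Proof.
move=> u v w; apply/funext=> n.
rewrite -[RHS]/(cauchy u v n + cauchy u w n) -big_split.
by apply: eq_bigr => i _; exact: mulrDr.
Qed.
Lemma mono1_neq0 : mono 0 1 != 0.
Proof. by apply/eqP=> /(congr1 (fun u => u 0%N))/eqP; rewrite oner_eq0. Qed.

HB.instance Definition _ := GRing.Zmodule_isNzRing.Build powser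
  cauchyA cauchy1r cauchyr1 cauchyDl cauchyDr mono1_neq0.

Lemma powserME u v n : (u * v) n = \sum_(i < n.+1) u i * v (n - i)%N.
Proof. by []. Qed.

Lemma powserX_low (t : powser) k n : t 0%N = 0 -> (n < k)%N -> (t ^+ k) n = 0.
Proof.
move=> t0; elim: k n => // k IHk n ltnk; rewrite exprS powserME big1 // => i _.
case: i => -[|i] /= lti; first by rewrite t0 mul0r.
rewrite IHk ?mulr0 // subnS prednK ?subn_gt0 //.
by rewrite (leq_trans (leq_subr _ _)).
Qed.

(* The inverse of [u = u_0 (1 - t)] is the geometric series in [t]. *)
Lemma powser_inverse u c : u 0%N * c = 1 -> c * u 0%N = 1 -> exists w, u * w = 1.
Proof.
move=> uc cu; pose t := 1 - mono 0 c * u.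
have t0 : t 0%N = 0.
  by rewrite -[LHS]/(1 - cauchy (mono 0 c) u 0%N) cauchy_monol /= cu subrr.
(* Coefficient [n] of the geometric series is read off a partial sum, since the powers beyond
   [t ^+ n] have no term of degree [n]. *)
pose w : powser := fun n => (\sum_(k < n.+1) t ^+ k) n.
have sumE (I : finType) (f : I -> powser) n : (\sum_i f i) n = \sum_i f i n.
  by apply: (big_morph (fun u : powser => u n)).
have w_stable n i : (i <= n)%N -> w i = (\sum_(k < n.+1) t ^+ k) i.
  move=> lein; rewrite /w !sumE (big_ord_widen n.+1 (fun k => (t ^+ k) i)) ?ltnS //.
  rewrite big_mkcond; apply: eq_bigr => k _; case: ltnP => // ltik.
  by rewrite powserX_low.
exists (w * mono 0 c); suff tw : (1 - t) * w = 1.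
  have : mono 0 c * u * w = 1 by rewrite -[RHS]tw /t opprB addrC subrK.
  move=> E; have uc1 : mono 0 (u 0%N) * mono 0 c = 1.
    apply/funext=> n; rewrite [LHS]cauchy_monol ltn0 subn0 /mono.
    by rewrite -[RHS]/(if n == 0%N then 1 else 0); case: eqP; rewrite ?mulr0.
  have uw : u * w = mono 0 (u 0%N).
    by rewrite -[u * w]mul1r -uc1 -mulrA [mono 0 c * _]mulrA E mulr1.
  by rewrite mulrA uw uc1.
apply/funext=> n.
transitivity (((1 - t) * \sum_(k < n.+1) t ^+ k) n).
  rewrite !powserME; apply: eq_bigr => i _; congr (_ * _).
  by apply: w_stable; rewrite leq_subr.
have -> : (1 - t) * \sum_(k < n.+1) t ^+ k = 1 - t ^+ n.+1.
  by rewrite -[1 - t]opprB mulNr -subrX1 opprB.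
by rewrite -[LHS]/(_ - (t ^+ n.+1) n) powserX_low // subr0.
Qed.

End PowerSeries.

Section Laurent.

Variable F : nzRingType.
Implicit Types (u v : powser F) (k l : nat) (n : int).

(* The coefficients of X^-k u. *)
Definition lrep k u : int -> F := fun n => if n + k%:Z is Posz j then u j else 0.

Lemma lrep_shift l k u : lrep (k + l) (mono l 1 * u) = lrep k u.
Proof.
apply/funext=> n; rewrite /lrep; case E: (n + k%:Z) => [j|j].
  have -> : n + (k + l)%N%:Z = (j + l)%N by lia.
  by rewrite [LHS]cauchy_monol ltnNge leq_addl /= mul1r addnK.
case E': (n + (k + l)%N%:Z) => [i|//].
by rewrite [LHS]cauchy_monol ifT //; lia.
Qed.

Lemma lrep_inj k : injective (lrep k).
Proof.
move=> u v /(congr1 (fun f => f (_ : int))) uv; apply/funext=> j.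
by move: (uv (j%:Z - k%:Z)); rewrite /lrep subrK.
Qed.

Lemma lrepD k u v n : lrep k (u + v) n = lrep k u n + lrep k v n.
Proof. by rewrite /lrep; case: (n + k%:Z) => // j; rewrite addr0. Qed.

Lemma lrepN k u n : lrep k (- u) n = - lrep k u n.
Proof. by rewrite /lrep; case: (n + k%:Z) => // j; rewrite oppr0. Qed.

(** The coefficient function is stored because the presentation X^-k u is not unique; equality is
    then equality of functions. *)
Record laurent := Laurent {
  lcoef :> int -> F;
  laurent_ex : exists k, exists u, lcoef = lrep k u }.

HB.instance Definition _ := gen_eqMixin laurent.
HB.instance Definition _ := gen_choiceMixin laurent.

Implicit Types x y z : laurent.

Lemma laurent_inj x y : lcoef x = lcoef y -> x = y.
Proof.
case: x y => [f fP] [g gP] /= fg; case: _ / fg gP => gP.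
by congr Laurent; exact: Prop_irrelevance.
Qed.

Definition lser k u : laurent := Laurent (ex_intro _ k (ex_intro _ u erefl)).

Lemma lserP x : exists k, exists u, x = lser k u.
Proof. by case: (laurent_ex x) => k [u xE]; exists k, u; apply: laurent_inj. Qed.

Lemma lser_shift l k u : lser k u = lser (k + l) (mono l 1 * u).
Proof. by apply: laurent_inj; rewrite /= lrep_shift. Qed.

Lemma lserP2 x y : exists k, exists u, exists v, x = lser k u /\ y = lser k v.
Proof.
have [k [u ->]] := lserP x; have [l [v ->]] := lserP y.
exists (k + l)%N, (mono l 1 * u), (mono k 1 * v).
by rewrite -lser_shift addnC -lser_shift.
Qed.

Lemma lserP3 x y z : exists k, exists u, exists v, exists w,
  [/\ x = lser k u, y = lser k v & z = lser k w].
Proof.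
have [k [u [v [-> ->]]]] := lserP2 x y; have [l [w ->]] := lserP z.
exists (k + l)%N, (mono l 1 * u), (mono l 1 * v), (mono k 1 * w).
by rewrite -!lser_shift addnC -lser_shift.
Qed.

Lemma ladd_subproof x y : exists k, exists u, (fun n => x n + y n) = lrep k u.
Proof.
have [k [u [v [-> ->]]]] := lserP2 x y; exists k, (u + v).
by apply/funext=> n; rewrite lrepD.
Qed.

Lemma lopp_subproof x : exists k, exists u, (fun n => - x n) = lrep k u.
Proof.
have [k [u ->]] := lserP x; exists k, (- u).
by apply/funext=> n; rewrite lrepN.
Qed.

Definition ladd x y := Laurent (ladd_subproof x y).
Definition lopp x := Laurent (lopp_subproof x).
Definition lmul x y : laurent :=
  let: exist k uP := cid (lserP x) in let: exist l vP := cid (lserP y) in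
  lser (k + l) (sval (cid uP) * sval (cid vP)).

Lemma laddE k u v : ladd (lser k u) (lser k v) = lser k (u + v).
Proof. by apply: laurent_inj; apply/funext=> n /=; rewrite lrepD. Qed.

Lemma mono1_comm k u : u * mono k 1 = mono k 1 * u.
Proof.
apply/funext=> n; rewrite [LHS]cauchy_monor [RHS]cauchy_monol.
by rewrite mulr1 mul1r.
Qed.

(** Makes [lmul] independent of the presentations it chooses: they are brought to common
    denominators, and powers of the variable commute with everything. *)
Lemma lser_mul_indep k k' l l' u u' v v' :
  lser k u = lser k' u' -> lser l v = lser l' v' ->
  lser (k + l) (u * v) = lser (k' + l') (u' * v').
Proof.
rewrite (lser_shift k' k) (lser_shift k k') addnC => /(congr1 lcoef)/lrep_inj uu.
rewrite (lser_shift l' l) (lser_shift l l') addnC => /(congr1 lcoef)/lrep_inj vv.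
rewrite (lser_shift (k' + l')) [RHS](lser_shift (k + l)) addnC; congr lser.
have monoD i j : mono (F := F) (i + j) 1 = mono i 1 * mono j 1.
  apply/funext=> n; rewrite [RHS]cauchy_monol mul1r /mono.
  case: ltnP => ?; first by rewrite ltn_eqF //; lia.
  by congr (if _ then _ else _); lia.
rewrite !monoD.
have -> a b (c d : powser F) : mono a 1 * mono b 1 * (c * d) = (mono a 1 * c) * (mono b 1 * d).
  by rewrite !mulrA -(mulrA (mono a 1) c) (mono1_comm b c) !mulrA.
by rewrite uu vv !mulrA -(mulrA (mono k 1) u') (mono1_comm l u') !mulrA.
Qed.

Lemma lmulE k l u v : lmul (lser k u) (lser l v) = lser (k + l) (u * v).
Proof.
rewrite /lmul; case: cid => k' uP; case: cid => l' vP.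
case: cid => u' /= uu; case: cid => v' /= vv.
exact/esym/lser_mul_indep.
Qed.

Lemma laddA : associative ladd.
Proof. by move=> x y z; apply: laurent_inj; apply/funext=> n /=; rewrite addrA. Qed.
Lemma laddC : commutative ladd.
Proof. by move=> x y; apply: laurent_inj; apply/funext=> n /=; rewrite addrC. Qed.
Lemma ladd0 : left_id (lser 0 0) ladd.
Proof.
move=> x; apply: laurent_inj; apply/funext=> n /=.
by rewrite /lrep; case: (n + 0) => j; rewrite add0r.
Qed.
Lemma laddN : left_inverse (lser 0 0) lopp ladd.
Proof.
move=> x; apply: laurent_inj; apply/funext=> n /=.
by rewrite addNr /lrep; case: (n + 0).
Qed.

HB.instance Definition _ := GRing.isZmodule.Build laurent laddA laddC ladd0 laddN.

Lemma lmulA : associative lmul.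
Proof.
move=> x y z; have [k [u ->]] := lserP x; have [l [v ->]] := lserP y.
by have [m [w ->]] := lserP z; rewrite !lmulE mulrA addnA.
Qed.
Lemma lmul1 : left_id (lser 0 1) lmul.
Proof. by move=> x; have [k [u ->]] := lserP x; rewrite lmulE mul1r. Qed.
Lemma lmulr1 : right_id (lser 0 1) lmul.
Proof. by move=> x; have [k [u ->]] := lserP x; rewrite lmulE mulr1 addn0. Qed.
Lemma lmulDl : left_distributive lmul ladd.
Proof.
move=> x y z; have [k [u [v [w [-> -> ->]]]]] := lserP3 x y z.
by rewrite !(laddE, lmulE) mulrDl.
Qed.
Lemma lmulDr : right_distributive lmul ladd.
Proof.
move=> x y z; have [k [u [v [w [-> -> ->]]]]] := lserP3 x y z.
by rewrite !(laddE, lmulE) mulrDr.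
Qed.
Lemma lser1_neq0 : lser 0 1 != 0.
Proof.
apply/eqP=> /(congr1 (fun x => lcoef x 0))/eqP.
by rewrite /= /lrep /= oner_eq0.
Qed.

HB.instance Definition _ := GRing.Zmodule_isNzRing.Build laurent
  lmulA lmul1 lmulr1 lmulDl lmulDr lser1_neq0.
HB.instance Definition _ := GRing.NzRing_hasMulInverse.Build laurent
  (@classical_mulVr _) (@classical_mulrV _) (@classical_unitP _)
  (@classical_inv_out _).

Lemma lserM k l u v : lser k u * lser l v = lser (k + l) (u * v).
Proof. exact: lmulE. Qed.

Lemma lcoef0 n : lcoef 0 n = 0.
Proof. by rewrite /= /lrep; case: (n + 0). Qed.

Definition lconst (c : F) : laurent := lser 0 (mono 0 c).
Definition lvar : laurent := lser 0 (mono 1 1).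

Lemma lconst_zmod_morphism : zmod_morphism lconst.
Proof.
move=> a b; apply: laurent_inj; apply/funext=> n /=; rewrite /lrep /mono.
by case: (n + 0) => [j|j]; [case: eqP|]; rewrite ?subr0.
Qed.
Lemma lconst_monoid_morphism : monoid_morphism lconst.
Proof.
split=> // a b; rewrite lserM; congr lser; apply/funext=> n.
by rewrite [RHS]cauchy_monol ltn0 subn0 /mono; case: eqP; rewrite ?mulr0.
Qed.
HB.instance Definition _ := GRing.isZmodMorphism.Build F laurent lconst lconst_zmod_morphism.
HB.instance Definition _ := GRing.isMonoidMorphism.Build F laurent lconst lconst_monoid_morphism.

Lemma lvar_central : central lvar.
Proof. by move=> x; have [k [u ->]] := lserP x; rewrite !lserM addnC mono1_comm. Qed.

Lemma lconst_central c : central c -> central (lconst c).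
Proof.
move=> cC x; have [k [u ->]] := lserP x; rewrite !lserM addnC; congr lser.
by apply/funext=> n; rewrite [LHS]cauchy_monol [RHS]cauchy_monor ltn0 cC.
Qed.

Lemma lcoef_const c n : lcoef (lconst c) n = if n == 0 then c else 0.
Proof. by rewrite /= /lrep addr0 /mono; case: n => [[|j]|j]. Qed.

Lemma lcoef_constX c n : lcoef (lconst c * lvar) n = if n == 1 then c else 0.
Proof.
rewrite lserM /= /lrep addr0; case: n => [[|[|j]]|j] //=;
  by rewrite [LHS]cauchy_monol /= /mono /= ?mulr0 ?mulr1.
Qed.

(** Here [n] and [m] only bound the orders from below; a single pair of terms contributes to degree
    [n + m]. *)
Lemma lcoefM_lead x y n m : (forall i : int, (i < n)%R -> lcoef x i = 0) ->
  (forall i : int, (i < m)%R -> lcoef y i = 0) ->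
  lcoef (x * y) (n + m) = lcoef x n * lcoef y m.
Proof.
have [k0 [u0 ->]] := lserP x; have [l0 [v0 ->]] := lserP y.
(* Larger denominators make [n + k] and [m + l] natural numbers. *)
rewrite (lser_shift `|n| k0) (lser_shift `|m| l0).
set k := (k0 + _)%N; set l := (l0 + _)%N; set u := _ * u0; set v := _ * v0.
move=> x0 y0; rewrite lserM.
have [i ni] : exists i : nat, n + k%:Z = i by exists `|(n + k%:Z)%R|%N; lia.
have [j mj] : exists j : nat, m + l%:Z = j by exists `|(m + l%:Z)%R|%N; lia.
have nmij : n + m + (k + l)%N%:Z = (i + j)%N by lia.
have u_low a : (a < i)%N -> u a = 0.
  by move=> ai; have := x0 (a%:Z - k%:Z); rewrite /= /lrep subrK; apply; lia.
have v_low a : (a < j)%N -> v a = 0.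
  by move=> aj; have := y0 (a%:Z - l%:Z); rewrite /= /lrep subrK; apply; lia.
rewrite /= /lrep nmij ni mj powserME (bigD1 (inord i)) //=.
rewrite inordK ?ltnS ?leq_addr // addnC addnK big1 ?addr0 // => a ai.
have [lta|lta|E] := ltngtP (a : nat) i.
- by rewrite u_low ?mul0r.
- by rewrite v_low ?mulr0 //; have := ltn_ord a; lia.
- by case/eqP: ai; apply: val_inj; rewrite /= inordK // ltnS leq_addl.
Qed.

End Laurent.

Lemma lser_lead (F : nzRingType) (x : laurent F) : x != 0 ->
  exists n, lcoef x n != 0 /\ forall i : int, (i < n)%R -> lcoef x i = 0.
Proof.
have [k [u ->]] := lserP x => x_neq0.
have [/= i ui mini] : exists2 i, u i != 0 & forall j, u j != 0 -> (i <= j)%N.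
  have exu : exists i, u i != 0.
    apply: contrapT => u0; case/eqP: x_neq0; apply: laurent_inj; apply/funext=> n.
    rewrite lcoef0 /= /lrep; case: (n + _) => // j; apply/eqP/negPn/negP => uj.
    by apply: u0; exists j.
  by case: (ex_minnP exu) => i; exists i.
exists (i%:Z - k%:Z); rewrite /= /lrep subrK; split=> // n ltn.
case E: (n + k%:Z) => [j|//]; apply/eqP; apply: contraTT ltn => /mini; lia.
Qed.

(** A nonzero series is a power of the variable times a power series with invertible constant
    coefficient. *)
Lemma laurent_skew (F : unitRingType) : GRing.field_axiom F ->
  GRing.field_axiom (laurent F).
Proof.
move=> skewF; apply: right_inverse_skew => x x_neq0.
have [n [xn x_low]] := lser_lead x_neq0.
have [k0 [u0 xE]] := lserP x.
have [k [u {}xE nk]] : exists k, exists2 u, x = lser k u & (0 <= n + k%:Z)%R.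
  by exists (k0 + `|n|)%N; eexists; [rewrite xE (lser_shift `|n|)|lia].
have [i ni] : exists i : nat, n + k%:Z = i by exists `|(n + k%:Z)%R|%N; lia.
pose v : powser F := fun j => u (j + i)%N.
have uE : u = mono i 1 * v.
  apply/funext=> j; rewrite [RHS]cauchy_monol; case: ltnP => ij.
    by have := x_low (j%:Z - k%:Z); rewrite xE /= /lrep subrK; apply; lia.
  by rewrite mul1r /v subnK.
have v0 : v 0%N \is a GRing.unit.
  by apply: skewF; move: xn; rewrite xE /= /lrep ni /v add0n.
have [w vw] := powser_inverse (mulrV v0) (mulVr v0).
exists (lser i (mono k 1 * w)); rewrite xE uE lserM.
have -> : mono i 1 * v * (mono k 1 * w) = mono (k + i) 1 * 1.
  rewrite mulrA -(mulrA _ v) mono1_comm mulrA -mulrA vw !mulr1.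
  apply/funext=> j; rewrite [LHS]cauchy_monol mul1r /mono.
  case: ltnP => ij; first by rewrite ltn_eqF //; lia.
  by congr (if _ then _ else _); lia.
by rewrite -[(k + i)%N]add0n -lser_shift.
Qed.

Section Sign.

Variable F : nzRingType.

Lemma lsign_subproof (x : laurent F) : exists k, exists u,
  (fun n => (-1) ^+ `|n|%N * x n) = lrep k u.
Proof.
have [k [u ->]] := lserP x; exists k, (fun j => (-1) ^+ (j + k) * u j).
apply/funext=> n; rewrite /= /lrep; case E: (n + k%:Z) => [j|]; last by rewrite mulr0.
by congr (_ * _); rewrite -[LHS]signr_odd -[RHS]signr_odd; congr (_ ^+ nat_of_bool _); lia.
Qed.

(** The substitution X |-> -X. *)
Definition lsign (x : laurent F) : laurent F := Laurent (lsign_subproof x).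

Lemma lsign_ser k (u : powser F) :
  lsign (lser k u) = lser k (fun j => (-1) ^+ (j + k) * u j).
Proof.
apply: laurent_inj; apply/funext=> n; rewrite /= /lrep.
case E: (n + k%:Z) => [j|]; last by rewrite mulr0.
by congr (_ * _); rewrite -[LHS]signr_odd -[RHS]signr_odd; congr (_ ^+ nat_of_bool _); lia.
Qed.

Lemma lsign_zmod_morphism : zmod_morphism lsign.
Proof.
move=> x y; apply: laurent_inj; apply/funext=> n.
by rewrite /= mulrBr.
Qed.
Lemma lsign_monoid_morphism : monoid_morphism lsign.
Proof.
split=> [|x y].
  apply: laurent_inj; apply/funext=> n; rewrite /= /lrep addr0.
  by case: n => [[|j]|j]; rewrite ?mulr0 // mul1r.
have [k [u ->]] := lserP x; have [l [v ->]] := lserP y.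
rewrite !lserM !lsign_ser lserM; congr lser; apply/funext=> n.
rewrite !powserME mulr_sumr; apply: eq_bigr => i _.
have -> : (n + (k + l))%N = ((i + k) + (n - i + l))%N by have := ltn_ord i; lia.
by rewrite exprD -!mulrA; congr (_ * _); rewrite !mulrA commr_sign.
Qed.
HB.instance Definition _ := GRing.isZmodMorphism.Build _ _ lsign lsign_zmod_morphism.
HB.instance Definition _ := GRing.isMonoidMorphism.Build _ _ lsign lsign_monoid_morphism.

Lemma lsignK : involutive lsign.
Proof.
by move=> x; apply: laurent_inj; apply/funext=> n; rewrite /= mulrA -expr2 sqrr_sign mul1r.
Qed.

Lemma lsign_const c : lsign (lconst c) = lconst c.
Proof.
apply: laurent_inj; apply/funext=> n; rewrite -[LHS]/(_ * lcoef (lconst c) n).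
by rewrite lcoef_const; case: eqP => [->|_]; rewrite ?mul1r ?mulr0.
Qed.

Lemma lsign_var : lsign (lvar F) = - lvar F.
Proof.
rewrite /lvar; apply: laurent_inj; apply/funext=> n.
by rewrite /= /lrep addr0 /mono; case: n => [[|[|j]]|j]; rewrite /= ?(mulr0, oppr0, expr1, mulN1r).
Qed.

End Sign.

(** * Cyclic algebras of degree 2 *)

Record twist (E : nzRingType) := Twist {
  tw_sig : {rmorphism E -> E};
  tw_s : E;
  tw_sigK : involutive tw_sig;
  tw_sC : central tw_s;
  tw_fix : tw_sig tw_s = tw_s }.

Definition quat (E : nzRingType) (t : twist E) : Type := (E * E)%type.

(* The cyclic algebra of pairs [f + g q] with [q f = sig f q] and [q^2 = s]. *)
Section Quaternion.

Variables (E : nzRingType) (t : twist E).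
Local Notation sig := (tw_sig t).
Local Notation s := (tw_s t).
Local Notation quat := (quat t).

HB.instance Definition _ := GRing.Zmodule.copy quat (E * E)%type.

Definition qmul (x y : quat) : quat :=
  (x.1 * y.1 + s * (x.2 * sig y.2), x.1 * y.2 + x.2 * sig y.1).

Let sM a b : a * (s * b) = s * (a * b).
Proof. by rewrite mulrA -(tw_sC t) -mulrA. Qed.

Lemma qmulA : associative qmul.
Proof.
case=> [a b] [c d] [e f]; rewrite /qmul /=; congr (_, _).
  rewrite !rmorphD !rmorphM /= tw_sigK !mulrDl !mulrDr sM !mulrA -!addrA.
  by congr (_ + _); rewrite [RHS]addrC -!addrA; congr (_ + _); rewrite addrC.
rewrite !rmorphD !rmorphM /= tw_sigK tw_fix !mulrDl !mulrDr -!mulrA sM !mulrA -!addrA.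
by congr (_ + _); rewrite [RHS]addrC -!addrA.
Qed.

Lemma qmul1 : left_id ((1, 0) : quat) qmul.
Proof. by case=> a b; rewrite /qmul /= !mul0r mulr0 !mul1r !addr0. Qed.
Lemma qmulr1 : right_id ((1, 0) : quat) qmul.
Proof. by case=> a b; rewrite /qmul /= rmorph0 rmorph1 !mulr0 !mulr1 addr0 add0r. Qed.
Lemma qmulDl : left_distributive qmul +%R.
Proof.
case=> [a b] [c d] [e f]; rewrite /qmul /=; congr (_, _).
  by rewrite !mulrDl mulrDr addrACA.
by rewrite !mulrDl addrACA.
Qed.
Lemma qmulDr : right_distributive qmul +%R.
Proof.
case=> [a b] [c d] [e f]; rewrite /qmul /=; congr (_, _).
  by rewrite rmorphD !mulrDr addrACA.
by rewrite rmorphD !mulrDr addrACA.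
Qed.
Lemma qone_neq0 : ((1, 0) : quat) != 0.
Proof. by apply/eqP=> -[/eqP]; rewrite oner_eq0. Qed.

HB.instance Definition _ := GRing.Zmodule_isNzRing.Build quat
  qmulA qmul1 qmulr1 qmulDl qmulDr qone_neq0.
HB.instance Definition _ := GRing.NzRing_hasMulInverse.Build quat
  (@classical_mulVr _) (@classical_mulrV _) (@classical_unitP _)
  (@classical_inv_out _).

(** Right multiplication by [x] on the left [E]-module with basis 1, q: the rows are the coordinates
    of [x] and of q x. *)
Definition qmat (x : quat) : bool -> bool -> E := fun i j =>
  match i, j with
  | false, false => x.1
  | false, true => x.2
  | true, false => s * sig x.2
  | true, true => sig x.1
  end.

Lemma qmatD x y i j : qmat (x + y) i j = qmat x i j + qmat y i j.
Proof.
by case: x y i j => [a b] [c d] [|] [|] //=; rewrite rmorphD ?mulrDr.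
Qed.

Lemma qmat0 i j : qmat 0 i j = 0.
Proof. by case: i j => [|] [|] //=; rewrite rmorph0 ?mulr0. Qed.

Lemma qmat_sum (I : finType) (f : I -> quat) i j :
  qmat (\sum_k f k) i j = \sum_k qmat (f k) i j.
Proof. by apply: (big_morph (fun x => qmat x i j)) => [x y|]; rewrite ?qmatD ?qmat0. Qed.

Lemma qmatM x y i j : qmat (x * y) i j = \sum_k qmat x i k * qmat y k j.
Proof.
rewrite big_bool; case: x y i j => [a b] [c d] [|] [|] /=.
all: rewrite ?rmorphD ?rmorphM /= ?tw_fix ?tw_sigK ?mulrDr -?mulrA ?sM.
1,2: by [].
1,2: exact: addrC.
Qed.

Definition qpair (f g : E) : quat := (f, g).
Definition qconst (c : E) : quat := (c, 0).

Lemma qpairM a b c d :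
  qpair a b * qpair c d = qpair (a * c + s * (b * sig d)) (a * d + b * sig c).
Proof. by []. Qed.

End Quaternion.

(** For nonzero f, write f + g q = f (1 + h q). Then (1 + h q)(1 - h q) = 1 - s h sig(h) lies in
    [E], and it is nonzero because [s] is not a norm. *)
Lemma quat_skew (E : unitRingType) (t : twist E) : GRing.field_axiom E ->
  (forall g, g * tw_sig t g != tw_s t) -> GRing.field_axiom (quat t).
Proof.
move=> skewE nonnorm; apply: right_inverse_skew => -[f g].
have [-> g0|f_neq0 _] := eqVneq f 0.
  have {}g0 : g != 0 by apply: contraNneq g0 => ->.
  (* The case [g = 0] of [nonnorm] says that [s] is nonzero. *)
  have Us : tw_s t \is a GRing.unit.
    by apply/skewE; have := nonnorm 0; rewrite mul0r eq_sym.
  exists (qpair t 0 (tw_sig t (g^-1 * (tw_s t)^-1))).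
  rewrite [LHS]qpairM rmorph0 !(mul0r, mulr0, add0r) tw_sigK.
  by rewrite mulVKr ?skewE // mulrV.
have Uf := skewE _ f_neq0; pose h := f^-1 * g.
have Ud : 1 - tw_s t * (h * tw_sig t h) \is a GRing.unit.
  (* Otherwise [s] would be the norm of [(sig h)^-1]. *)
  apply/skewE; rewrite subr_eq0; apply: contraNneq (nonnorm (tw_sig t h)^-1) => E1.
  have Uh : h * tw_sig t h \is a GRing.unit.
    apply/skewE/eqP => h0; move/eqP: E1; rewrite h0 mulr0.
    by rewrite oner_eq0.
  have h0 : h != 0 by apply: contraTneq Uh => ->; rewrite mul0r unitr0.
  have sh0 : tw_sig t h != 0 by apply: contraTneq Uh => ->; rewrite mulr0 unitr0.
  have Usig := skewE _ sh0; have Uh' := skewE _ h0.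
  have -> : tw_sig t (tw_sig t h)^-1 = h^-1 by rewrite rmorphV // tw_sigK.
  by rewrite -invrM //; apply/eqP/(mulIr Uh); rewrite mulVr // E1.
pose d := 1 - tw_s t * (h * tw_sig t h).
exists (qpair t 1 (- h) * qpair t d^-1 0 * qpair t f^-1 0).
have -> : (f, g) = qpair t f 0 * qpair t 1 h.
  rewrite qpairM !(mul0r, mulr0, mulr1, addr0); congr (_, _).
  by rewrite /h mulrA mulrV // mul1r.
have E1 : qpair t 1 h * qpair t 1 (- h) = qpair t d 0.
  by rewrite qpairM rmorph1 rmorphN !(mulr1, mul1r, mulrN) addNr.
have qM a b : qpair t a 0 * qpair t b 0 = qpair t (a * b) 0.
  by rewrite qpairM !(mul0r, mulr0, addr0).
rewrite -!mulrA (mulrA (qpair t 1 h)) E1 (mulrA (qpair t d 0)) !qM mulrV //.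
by rewrite mul1r mulrV.
Qed.

(** * Specializations of the free skew field *)

Section FreeAlgebra.

Variables (F : fieldType) (n : nat).

Section Eval.

Variables (K : nzRingType) (io : {rmorphism F -> K}) (y : 'I_n -> K).
Hypothesis ioC : forall r, central (io r).

Definition monom_eval (m : {fmonom 'I_n}) : K := \prod_(i <- fmonom_val m) y i.

Lemma monom_eval_morphism : mmorphism monom_eval.
Proof.
split=> [m m'|]; rewrite /monom_eval; first by rewrite fmM big_cat.
by rewrite fm1 big_nil.
Qed.
HB.instance Definition _ := monalg.isMultiplicative.Build {fmonom 'I_n} K
  monom_eval monom_eval_morphism.

(** The proof of centrality is an argument, so that the morphism structure, which depends on it, can
    be inferred from the term. *)
Definition free_eval (_ : forall r, central (io r)) (a : free_algebra F n) : K :=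
  mmap io monom_eval a.

Lemma free_eval_zmod_morphism : zmod_morphism (free_eval ioC).
Proof. by move=> a b; rewrite /free_eval mmapB. Qed.
Lemma free_eval_monoid_morphism : monoid_morphism (free_eval ioC).
Proof.
have [] : multiplicative (mmap io monom_eval).
  by apply: commr_mmap_is_multiplicative => g m m'; apply: ioC.
by split.
Qed.
HB.instance Definition _ := GRing.isZmodMorphism.Build (free_algebra F n) K
  (free_eval ioC) free_eval_zmod_morphism.
HB.instance Definition _ := GRing.isMonoidMorphism.Build (free_algebra F n) K
  (free_eval ioC) free_eval_monoid_morphism.

Lemma free_eval_scalar r : free_eval ioC (r%:A) = io r.
Proof. by rewrite /free_eval mmapZ mmap1 mulr1. Qed.

Lemma free_eval_var i : free_eval ioC << fmu i >> = y i.
Proof.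
by rewrite /free_eval mmapU /= rmorph1 mul1r /monom_eval fmU big_seq1.
Qed.

End Eval.

Lemma free_algebra_gen (K : nzRingType) (f : {rmorphism free_algebra F n -> K})
    (S : {pred K}) : subring_closed S -> (forall r, f r%:A \in S) ->
  (forall i, f << fmu i >> \in S) -> forall a, f a \in S.
Proof.
move=> [S1 SB SM] SF Sx a.
have S0 : 0 \in S by rewrite -(subrr 1) SB.
have SD : {in S &, forall a b, a + b \in S}.
  by move=> b c Sb Sc; rewrite -[c]opprK -[- c]sub0r !SB.
rewrite (monalgE a) rmorph_sum; elim/big_ind: _ => // -[s] _.
have -> : << a@_(FMonom s) *g FMonom s >> =
   (a@_(FMonom s))%:A * << FMonom s >> :> free_algebra F n.
  apply/malgP => k; rewrite -mul_malgC mulr1 mul_malgC mcoeffZ !mcoeffU.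
  by case: eqP; rewrite ?mulr1 ?mulr0.
rewrite rmorphM; apply/SM => //; elim: s => [|i s IHs].
  by rewrite -fmoneE (rmorph1 f).
have -> : << FMonom (i :: s) >> = << fmu i >> * << FMonom s >> :> free_algebra F n.
  rewrite [RHS]malgM_def fgmulUU mulr1 fmuE; congr << _ *g _ >>; exact/esym/fmmulE.
by rewrite rmorphM SM.
Qed.

End FreeAlgebra.

Section EpicSubfield.

Variables (T : nzRingType) (K : unitRingType) (g : {rmorphism T -> K}).

(** The universal property only concerns epic fields, so a morphism to an arbitrary skew field is
    first corestricted to the skew subfield generated by its image. *)
Definition generated : {pred K} := [pred a | `[< forall S : {pred K},
  divring_closed S -> (forall r, g r \in S) -> a \in S >]].

Lemma generatedP a : reflect (forall S : {pred K}, divring_closed S ->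
  (forall r, g r \in S) -> a \in S) (a \in generated).
Proof. exact: asboolP. Qed.

Lemma generated_divring_closed : divring_closed generated.
Proof.
split=> [|a b /generatedP ga /generatedP gb|a b /generatedP ga /generatedP gb];
  apply/generatedP => S Sdiv gS; have [S1 SB SM] := Sdiv; first exact: S1.
- by apply: SB; [exact: ga|exact: gb].
- by apply: SM; [exact: ga|exact: gb].
Qed.

HB.instance Definition _ := GRing.isDivringClosed.Build K generated
  generated_divring_closed.

Definition generated_field := {a : K | a \in generated}.

HB.instance Definition _ := SubChoice.on generated_field.
HB.instance Definition _ := [SubChoice_isSubUnitRing of generated_field by <:].

Lemma generated_mem r : g r \in generated.
Proof. by apply/generatedP. Qed.

Definition generated_mor r : generated_field := Sub (g r) (generated_mem r).

Lemma generated_mor_zmod_morphism : zmod_morphism generated_mor.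
Proof. by move=> a b; apply: val_inj; rewrite /= rmorphB. Qed.
Lemma generated_mor_monoid_morphism : monoid_morphism generated_mor.
Proof. by split=> [|a b]; apply: val_inj; rewrite /= ?rmorph1 ?rmorphM. Qed.
HB.instance Definition _ := GRing.isZmodMorphism.Build T generated_field
  generated_mor generated_mor_zmod_morphism.
HB.instance Definition _ := GRing.isMonoidMorphism.Build T generated_field
  generated_mor generated_mor_monoid_morphism.

Lemma generated_epic : skew_field K -> epic_field generated_mor.
Proof.
move=> skewK; split=> [a a_neq0|S [S1 SB SM] gS a].
  have Ua : val a \is a GRing.unit by apply: skewK; rewrite -(inj_eq val_inj) in a_neq0.
  apply/unitrP; exists (Sub (val a)^-1 (rpredVr (valP a))).
  by split; apply: val_inj; rewrite /= ?mulVr ?mulrV.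
(* A division-closed set of the subtype is pushed forward to [K], where membership in [generated]
   applies to it. *)
pose S' : {pred K} := [pred b | `[< exists2 c : generated_field, c \in S & val c = b >]].
have inS' c : c \in S -> val c \in S' by move=> Sc; apply/asboolP; exists c.
have S'P b : b \in S' -> exists2 c : generated_field, c \in S & val c = b by move/asboolP.
suff : val a \in S' by case/S'P => c Sc /val_inj <-.
have /generatedP := valP a; apply=> [|r]; last exact: (inS' (generated_mor r)).
split=> [|_ _ /S'P[b Sb <-] /S'P[c Sc <-]|_ _ /S'P[b Sb <-] /S'P[c Sc <-]].
- exact: (inS' 1).
- by rewrite -rmorphB inS' ?SB.
- have [Uc|nUc] := boolP (c \is a GRing.unit).
    by rewrite -rmorphV // -rmorphM inS' ?SM.
  (* Division by a nonunit must be checked too; the only one is 0, whose inverse is 0. *)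
  have -> : c = 0 by apply/eqP; apply: contraNT nUc => c0; apply/unitrP;
   have Uc : val c \is a GRing.unit by [apply: skewK; rewrite -(inj_eq val_inj) in c0];
   exists (Sub (val c)^-1 (rpredVr (valP c)));
   split; apply: val_inj; rewrite /= ?mulVr ?mulrV.
  by rewrite rmorph0 invr0 mulr0; apply: (inS' 0); rewrite -(subrr 1) SB.
Qed.

End EpicSubfield.

Section UniversalEval.

Variables (F : fieldType) (n : nat) (U : freeSkewField F n).

Lemma free_skew_field_skew : skew_field U.
Proof. by have [[]] := free_skew_field_universal U. Qed.

Lemma incl_scalar (r : F) : free_skew_field_incl U r%:A = r%:A.
Proof. by rewrite linearZ rmorph1. Qed.

Lemma free_skew_field_gen (S : {pred U}) : divring_closed S ->
  (forall r : F, r%:A \in S) -> (forall i, gen U i \in S) -> forall a, a \in S.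
Proof.
move=> Sdiv SF Sx; have [[_ Ugen] _ _] := free_skew_field_universal U.
apply: Ugen => //; apply: free_algebra_gen => // [|r].
  split; [by case: Sdiv|by case: Sdiv|].
  have [S1 SB SV] := Sdiv; have Sinv a : a \in S -> a^-1 \in S.
    by move=> Sa; rewrite -[a^-1]mul1r SV.
  by move=> a b Sa Sb; rewrite -[b]invrK SV // Sinv.
by have := SF r; rewrite -incl_scalar.
Qed.

(** The form in which the universal property is used: evaluation at any point of a skew field with
    central scalars, defined on a local subring that contains the variables. *)
Lemma universal_eval (K : unitRingType) (io : {rmorphism F -> K}) (y : 'I_n -> K) :
  skew_field K -> (forall r, central (io r)) ->
  exists (S : {pred U}) (h : U -> K),
    [/\ [/\ subring_closed S, forall r : F, r%:A \in S & forall i, gen U i \in S],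
        {in S &, {morph h : a b / a - b}} /\ {in S &, {morph h : a b / a * b}},
        (forall r : F, h r%:A = io r) /\ (forall i, h (gen U i) = y i)
      & {in S, forall a, h a != 0 -> a^-1 \in S}].
Proof.
move=> skewK ioC; pose g : {rmorphism free_algebra F n -> K} := free_eval y ioC.
have [_ _ /(_ _ _ (generated_epic g skewK))] := free_skew_field_universal U.
case=> S [h [[Ssub ST] [h1 hB hM] hg hV]].
exists S, (fun a => val (h a)); split.
- by split=> // [r|i]; [rewrite -incl_scalar|]; exact: ST.
- by split=> a b Sa Sb; [rewrite hB // rmorphB | rewrite hM // rmorphM].
- split=> [r|i]; first by rewrite -incl_scalar hg /= free_eval_scalar.
  by rewrite hg /= free_eval_var.
- by move=> a Sa ha; apply: hV => //; apply: contraNneq ha => ->.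
Qed.

End UniversalEval.

Arguments free_skew_field_skew {F n} U x _.

(** * Rank of a pencil at a matrix point *)

Lemma skew_mulf_neq0 (L : unitRingType) (a b : L) : GRing.field_axiom L ->
  a != 0 -> b != 0 -> a * b != 0.
Proof.
move=> skewL /skewL Ua /skewL Ub; apply: contraTneq (Ub) => ab0.
by rewrite -(mulKr Ua b) ab0 mulr0 unitr0.
Qed.

Lemma qconst_zmod_morphism (E : nzRingType) (t : twist E) : zmod_morphism (@qconst E t).
Proof. by move=> a b; rewrite /qconst; congr (_, _); rewrite /= subr0. Qed.
Lemma qconst_monoid_morphism (E : nzRingType) (t : twist E) : monoid_morphism (@qconst E t).
Proof.
split=> // a b; rewrite -[RHS]/(qpair t a 0 * qpair t b 0) qpairM.
by rewrite rmorph0 !(mulr0, mul0r, addr0).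
Qed.
HB.instance Definition _ (E : nzRingType) (t : twist E) :=
  GRing.isZmodMorphism.Build E (quat t) (@qconst E t) (qconst_zmod_morphism t).
HB.instance Definition _ (E : nzRingType) (t : twist E) :=
  GRing.isMonoidMorphism.Build E (quat t) (@qconst E t) (qconst_monoid_morphism t).

Lemma qconstM (E : nzRingType) (t : twist E) (c a b : E) :
  qconst t c * qpair t a b = qpair t (c * a) (c * b).
Proof. by rewrite [LHS]qpairM !(mul0r, mulr0, addr0). Qed.

Lemma qconst_central (E : nzRingType) (t : twist E) (c : E) :
  central c -> tw_sig t c = c -> central (qconst t c).
Proof.
move=> cC sc [a b]; rewrite [LHS]qconstM [RHS]qpairM sc rmorph0 !(mul0r, mulr0, addr0, add0r).
by rewrite !cC.
Qed.

Lemma lconst_inj (F : nzRingType) : injective (@lconst F).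
Proof.
by move=> a b /(congr1 (fun x => lcoef x 0)); rewrite !lcoef_const.
Qed.

Lemma lconstX_inj (F : nzRingType) : injective (fun a => @lconst F a * lvar F).
Proof.
by move=> a b /(congr1 (fun x => lcoef x 1)); rewrite !lcoef_constX.
Qed.

Section NonNorm.

Variable W : unitRingType.
Hypothesis skewW : GRing.field_axiom W.

(** A nonzero square has even order, and the right side has order 1. *)
Lemma lvar_nonsquare (c : W) (g : laurent W) : c != 0 -> g * g != lconst c * lvar W.
Proof.
move=> c0; apply/eqP => E; have [g0|/lser_lead[m [gm g_low]]] := eqVneq g 0.
  move/(congr1 (fun x => lcoef x 1)): E; rewrite g0 mulr0 lcoef_constX lcoef0.
  by move/esym/eqP; apply/negP.
have := lcoefM_lead g_low g_low; rewrite E lcoef_constX.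
have -> : (m + m == 1) = false by apply/eqP; lia.
by move/esym/eqP; apply/negP; rewrite skew_mulf_neq0.
Qed.

(** If [g] has order m, its norm has the leading coefficient (-1)^m g_m^2 in degree 2m. A constant
    norm forces m = 0, and then the sign disappears. *)
Lemma lconst_nonnorm (x : W) (g : laurent W) : x != 0 -> g * lsign g = lconst x ->
  exists a, a * a = x.
Proof.
move=> x0 E; have [g0|/lser_lead[m [gm g_low]]] := eqVneq g 0.
  move/(congr1 (fun x => lcoef x 0)): E; rewrite g0 mul0r lcoef_const lcoef0.
  by move/esym/eqP; rewrite (negPf x0).
have g_low' i : (i < m)%R -> lcoef (lsign g) i = 0.
  by move=> im; rewrite -[LHS]/(_ * lcoef g i) g_low ?mulr0.
have := lcoefM_lead g_low g_low'; rewrite E lcoef_const.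
case: eqP => [mm0|_].
  have -> : m = 0 by lia.
  rewrite -[lcoef (lsign g) 0]/(1 * lcoef g 0) mul1r => ->.
  by exists (lcoef g 0).
have sgn0 : (-1) ^+ `|m|%N != 0 :> W.
  by apply: contraTneq (unitrX `|m|%N (unitrN1 W)) => ->; rewrite unitr0.
have nz := skew_mulf_neq0 skewW gm (skew_mulf_neq0 skewW sgn0 gm).
by rewrite -[lcoef (lsign g) m]/(_ * lcoef g m) => /esym/eqP; rewrite (negPf nz).
Qed.

End NonNorm.

Lemma inverse_mat_map (L L' : nzRingType) (h : {rmorphism L -> L'}) (I J : finType)
    (M : I -> J -> L) N : inverse_mat M N ->
  inverse_mat (fun i j => h (M i j)) (fun i j => h (N i j)).
Proof.
move=> [MN NM]; split; apply: matP => i j; rewrite /mulm /idm.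
  under eq_bigr do rewrite -rmorphM.
  by rewrite -rmorph_sum -[\sum_k _]/(mulm M N i j) MN /idm rmorph_nat.
under eq_bigr do rewrite -rmorphM.
by rewrite -rmorph_sum -[\sum_k _]/(mulm N M i j) NM /idm rmorph_nat.
Qed.

Section Pencils.

Variables (F : numFieldType) (n : nat).
Implicit Types I J K H B : finType.

(* [None] indexes the constant term. *)
Definition pencil I J := option 'I_n -> I -> J -> F.

Section Evaluation.

Variables (W : nzRingType) (io : {rmorphism F -> W}).

Definition point B (y : 'I_n -> B -> B -> W) : option 'I_n -> B -> B -> W :=
  fun o => if o is Some k then y k else @idm W B.

(** The sum of the Kronecker products Phi_o (x) X_o. The constant term is multiplied by a matrix as
    well, which makes the evaluation linear in [X]. *)
Definition pencil_eval B (X : option 'I_n -> B -> B -> W) I J (Phi : pencil I J) :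
    I * B -> J * B -> W :=
  fun p q => \sum_o io (Phi o p.1 q.1) * X o p.2 q.2.

Lemma pencil_evalD B (X Y : option 'I_n -> B -> B -> W) (z : W) I J (Phi : pencil I J) p q :
  central z -> pencil_eval (fun o b c => X o b c + z * Y o b c) Phi p q =
  pencil_eval X Phi p q + z * pencil_eval Y Phi p q.
Proof.
move=> zC; rewrite /pencil_eval mulr_sumr -big_split; apply: eq_bigr => o _.
by rewrite mulrDr mulrA -zC mulrA.
Qed.

End Evaluation.

Variable U : freeSkewField F n.

Definition pencil_gen I J (Phi : pencil I J) : I -> J -> U :=
  fun i j => \sum_o (Phi o i j)%:A * oapp (gen U) 1 o.

(* The rank of a pencil at a matrix point is at most [#|B|] times its rank over
   [U]: a factorization bounds the latter from above, and an invertible minor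
   bounds the former from below. *)
Definition rank_bounded B : Prop :=
  forall (W : unitRingType) (io : {rmorphism F -> W}) (y : 'I_n -> B -> B -> W),
    GRing.field_axiom W -> (forall r, central (io r)) ->
  forall I J H (Phi : pencil I J) (P : I -> H -> U) (Q : H -> J -> U),
    pencil_gen Phi = mulm P Q ->
  forall K (f : K -> I * B) (g : K -> J * B) N,
    inverse_mat (fun k l => pencil_eval io (point y) Phi (f k) (g l)) N ->
  (#|K| <= #|B| * #|H|)%N.

(** [U] specializes to [W] by x_k |-> y_k. An invertible minor of the image lifts to an invertible
    minor over [U], where the factorization bounds it. *)
Lemma rank_bounded_unit : rank_bounded unit.
Proof.
move=> W io y skewW ioC I J H Phi P Q E K f g N invN.
have [S [h [[Ssub SF Sx] [hB hM] [hF hx] hV]]] :=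
  universal_eval U (fun k => y k tt tt) skewW ioC.
have [S1 _ SM] := Ssub.
have h1 : h 1 = 1 by rewrite -[1]scale1r hF rmorph1.
have evE i j : pencil_gen Phi i j \in S /\
    h (pencil_gen Phi i j) = pencil_eval io (point y) Phi (i, tt) (j, tt).
  have [|-> ->] := @subring_morph_sum _ _ S h Ssub hB _
     (fun o => (Phi o i j)%:A * oapp (gen U) 1 o).
    by case=> [k|] /=; rewrite SM.
  split=> //; apply: eq_bigr => -[k|] _ /=; rewrite hM ?hF ?hx // h1.
  by rewrite /idm eqxx.
have inM k l : pencil_gen Phi (f k).1 (g l).1 \in S by case: (evE (f k).1 (g l).1).
have EM : (fun k l => h (pencil_gen Phi (f k).1 (g l).1)) =
    (fun k l => pencil_eval io (point y) Phi (f k) (g l)).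
  by apply: matP => k l; rewrite (evE _ _).2; case: (f k) (g l) => [i []] [j []].
rewrite -EM in invN.
have [N' inv'] := local_inverse (free_skew_field_skew U) skewW Ssub hB hM hV inM invN.
by rewrite card_unit mul1n; exact: (minor_card (free_skew_field_skew U)
  (f := fun k => (f k).1) (g := fun k => (g k).1) E inv').
Qed.

(** * Doubling the size of the point by means of a cyclic algebra *)

Section Doubling.

Variables (W : unitRingType) (io : {rmorphism F -> W}).
Hypothesis skewW : GRing.field_axiom W.
Hypothesis ioC : forall r, central (io r).

Local Notation L := (laurent W).
Local Notation E := (laurent L).
Let emb (a : W) : E := lconst (lconst a).
Let ioE : {rmorphism F -> E} := @lconst L \o (@lconst W \o io).
Let ioEC r : central (ioE r).
Proof. by do 2!apply: lconst_central; exact: ioC. Qed.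
Let skewE : GRing.field_axiom E.
Proof. by do 2!apply: laurent_skew. Qed.
(** [E] has two variables. [px c] is a multiple of the outer one, which [lsign] negates; [sx c] is a
    multiple of the inner one, constant for the outer series and so fixed by [lsign]. *)
Let px (c : F) : E := ioE c * lvar L.
Let sx (c : F) : E := lconst (lconst (io c) * lvar W).

Let pxC c : central (px c).
Proof. by apply: centralM; [exact: ioEC|exact: lvar_central]. Qed.
Let sxC c : central (sx c).
Proof.
apply: lconst_central; apply: centralM; last exact: lvar_central.
exact/lconst_central/ioC.
Qed.

Definition doubling_twist (c : F) : twist E :=
  @Twist _ (@lsign L) (sx c) (@lsignK L) (@sxC c) (lsign_const _).

Let lsign_px c : lsign (px c) = - px c.
Proof. by rewrite /px rmorphM /= lsign_var lsign_const mulrN. Qed.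

(** A nonzero constant that is a norm for [lsign] is a square of a coefficient, but [sx c] comes
    from a series of order 1. *)
Lemma doubling_skew c : c != 0 -> GRing.field_axiom (quat (doubling_twist c)).
Proof.
move=> c0; apply: quat_skew => // g /=; apply/eqP => norm_g.
have ioc0 : io c != 0 by rewrite fmorph_eq0.
have [|a] := lconst_nonnorm (laurent_skew skewW) _ norm_g.
  apply/eqP => /(congr1 (fun x => lcoef x 1))/eqP.
  by rewrite lcoef_constX lcoef0 (negPf ioc0).
by apply/eqP/lvar_nonsquare.
Qed.

Variables (B : finType) (y : 'I_n -> B * bool -> B * bool -> W).

Let half : W := io 2%:R^-1.
Let half_sum a : half * a + half * a = a.
Proof.
have hh : half + half = 1.
  by rewrite -rmorphD -[2%:R^-1]mul1r -splitr rmorph1.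
by rewrite -mulrDl hh mul1r.
Qed.

Let al k b c := half * (y k (b, false) (c, false) + y k (b, true) (c, true)).
Let be k b c := half * (y k (b, false) (c, false) - y k (b, true) (c, true)).
Let ga k b c := half * (y k (b, false) (c, true) + y k (b, true) (c, false)).
Let de k b c := half * (y k (b, false) (c, true) - y k (b, true) (c, false)).

Let half_add a b : half * (a + b) + half * (a - b) = a.
Proof. by rewrite -mulrDr addrACA subrr addr0 mulrDr half_sum. Qed.
Let half_sub a b : half * (a + b) - half * (a - b) = b.
Proof. by rewrite -mulrBr opprB [a + b]addrC addrACA addrN addr0 mulrDr half_sum. Qed.

Let blk (a b c d : E) (i j : bool) : E :=
  match i, j with false, false => a | false, true => b | true, false => c | true, true => d end.

(** Two lines of matrices: [X0 + u X1] passes through [y] at u = 1, and [Z0 u + v Z1 u] passes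
    through [X0 + u X1] at v = 1. *)
Let X0 o (p q : B * bool) : E := if o is Some k then
  blk (emb (al k p.1 q.1)) (emb (ga k p.1 q.1)) (emb (ga k p.1 q.1)) (emb (al k p.1 q.1)) p.2 q.2
  else @idm E _ p q.
Let X1 o (p q : B * bool) : E := if o is Some k then
  blk (emb (be k p.1 q.1)) (emb (de k p.1 q.1))
    (- emb (de k p.1 q.1)) (- emb (be k p.1 q.1)) p.2 q.2
  else 0.
Let Z0 u o (p q : B * bool) : E := if o is Some k then
  blk (emb (al k p.1 q.1) + u * emb (be k p.1 q.1)) (emb (ga k p.1 q.1) + u * emb (de k p.1 q.1))
    0 (emb (al k p.1 q.1) - u * emb (be k p.1 q.1)) p.2 q.2
  else @idm E _ p q.
Let Z1 u o (p q : B * bool) : E := if o is Some k then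
  blk 0 0 (emb (ga k p.1 q.1) - u * emb (de k p.1 q.1)) 0 p.2 q.2
  else 0.

Let embE : @lconst L \o @lconst W =1 emb. Proof. by []. Qed.

Let X_at1 o p q : X0 o p q + 1 * X1 o p q = emb (point y o p q).
Proof.
case: o p q => [k|] [b i] [c j]; rewrite mul1r /=; last first.
  by rewrite addr0 /idm -embE rmorph_nat.
by case: i j => [|] [|]; rewrite /= -!embE -?rmorphB -?rmorphD ?half_add ?half_sub.
Qed.

Let X_to_Z u o p q : X0 o p q + u * X1 o p q = Z0 u o p q + 1 * Z1 u o p q.
Proof.
case: o p q => [k|] [b i] [c j]; rewrite mul1r /=; last by rewrite mulr0 !addr0.
by case: i j => [|] [|]; rewrite /= ?mulrN ?addr0 ?add0r.
Qed.

(* The 2 x 2 blocks of [y] are [al + be, ga + de; ga - de, al - be].  Inserting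
   central parameters, [al + u be, ga + u de; v (ga - u de), al - u be] is the
   matrix of a quaternion for [u = px c] and [v = sx d]; the parameters move from
   1 to these values one at a time. *)
Definition doubled_point (c d : F) (k : 'I_n) (b b' : B) : quat (doubling_twist d) :=
  qpair _ (emb (al k b b') + px c * emb (be k b b')) (emb (ga k b b') + px c * emb (de k b b')).

Let Z_qmat c d o p q : Z0 (px c) o p q + sx d * Z1 (px c) o p q =
  qmat (point (doubled_point c d) o p.1 q.1) p.2 q.2.
Proof.
case: o p q => [k|] [b i] [b' j] /=; last first.
  rewrite mulr0 addr0 /idm xpair_eqE; case: eqP => _.
    by case: i j => [|] [|] //=; rewrite ?rmorph1 ?rmorph0 ?mulr0.
  by rewrite qmat0.
have sigE a : lsign (emb a) = emb a by exact: lsign_const.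
case: i j => [|] [|] /=; rewrite ?(mulr0, addr0, add0r) //.
- by rewrite rmorphD rmorphM /= lsign_px !sigE mulNr.
- by rewrite rmorphD rmorphM /= lsign_px !sigE mulNr.
Qed.

Lemma doubling_minor I J K (Phi : pencil I J) (f : K -> I * (B * bool))
    (g : K -> J * (B * bool)) N :
  inverse_mat (fun k l => pencil_eval io (point y) Phi (f k) (g l)) N ->
  exists c d, d != 0 /\ exists N', inverse_mat (fun k l => pencil_eval ioE
    (fun o p q => qmat (point (doubled_point c d) o p.1 q.1) p.2 q.2) Phi (f k) (g l)) N'.
Proof.
move=> /(inverse_mat_map (@lconst L \o @lconst W)) inv0.
have ltK : (#|K| < #|'I_#|K|.+1|)%N by rewrite card_ord.
have nat_inj m : injective (fun t : 'I_m => t.+1%:R : F).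
  by move=> t t' /eqP; rewrite eqr_nat => /eqP[] /val_inj.
have one_central : central (1 : E) by move=> x; rewrite mul1r mulr1.
have inv1 : inverse_mat (fun k l => pencil_eval ioE X0 Phi (f k) (g l) +
    1 * pencil_eval ioE X1 Phi (f k) (g l)) (fun i j => emb (N i j)).
  rewrite (_ : (fun k l => _) = (fun k l => emb (pencil_eval io (point y) Phi (f k) (g l)))) //.
  apply: matP => k l; rewrite -pencil_evalD // -embE /pencil_eval rmorph_sum.
  by apply: eq_bigr => o _; rewrite X_at1 rmorphM.
(* The parameter takes [#|K| + 1] distinct central values, one more than the size of the minor;
   distinctness comes from characteristic 0. *)
have [||t [N1 inv2]] := pencil_generic (z := fun t : 'I_#|K|.+1 => px t.+1%:R)
  skewE ltK one_central _ _ inv1.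
- by move=> t; exact: pxC.
- move=> t t' /lconstX_inj/lconst_inj/fmorph_inj; exact: nat_inj.
set c : F := t.+1%:R in inv2.
have {}inv2 : inverse_mat (fun k l => pencil_eval ioE (Z0 (px c)) Phi (f k) (g l) +
    1 * pencil_eval ioE (Z1 (px c)) Phi (f k) (g l)) N1.
  rewrite (_ : (fun k l => _) = (fun k l => pencil_eval ioE X0 Phi (f k) (g l) +
    px c * pencil_eval ioE X1 Phi (f k) (g l))) //.
  apply: matP => k l; rewrite -!pencil_evalD //; apply: eq_bigr => o _.
  by rewrite X_to_Z.
(* Counting from 1 makes [d] nonzero, which the cyclic algebra needs in order to be a skew field. *)
have [||t' [N2 inv3]] := pencil_generic (z := fun t : 'I_#|K|.+1 => sx t.+1%:R)
  skewE ltK one_central _ _ inv2.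
- by move=> t'; exact: sxC.
- move=> t1 t2 /lconst_inj/lconstX_inj/fmorph_inj; exact: nat_inj.
exists c, t'.+1%:R; split; first by rewrite pnatr_eq0.
exists N2; rewrite (_ : (fun k l => _) = (fun k l =>
    pencil_eval ioE (Z0 (px c)) Phi (f k) (g l) +
    sx t'.+1%:R * pencil_eval ioE (Z1 (px c)) Phi (f k) (g l))) //.
apply: matP => k l; rewrite -!pencil_evalD //; apply: eq_bigr => o _.
by rewrite Z_qmat.
Qed.

Definition doubled_scalar (d : F) : {rmorphism F -> quat (doubling_twist d)} :=
  @qconst E _ \o ioE.

Lemma doubled_scalar_central d r : central (doubled_scalar d r).
Proof. by apply: qconst_central; [exact: ioEC|exact: lsign_const]. Qed.

Lemma doubled_pencil c d I J (Phi : pencil I J) i j b b' e e' :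
  pencil_eval ioE (fun o p q => qmat (point (doubled_point c d) o p.1 q.1) p.2 q.2) Phi
    (i, (b, e)) (j, (b', e')) =
  qmat (pencil_eval (doubled_scalar d) (point (doubled_point c d)) Phi (i, b) (j, b')) e e'.
Proof.
rewrite /pencil_eval qmat_sum.
apply: eq_bigr => o _ /=.
case: (point (doubled_point c d) o b b') => u v.
have sE : tw_sig (doubling_twist d) (ioE (Phi o i j)) = ioE (Phi o i j) by exact: lsign_const.
rewrite -[(u, v)]/(qpair (doubling_twist d) u v) qconstM; case: e e' => [|] [|] //=.
  by rewrite rmorphM; congr (_ * _); exact: esym sE.
rewrite rmorphM mulrA (ioEC _ (sx d)) -mulrA; congr (_ * (_ * _)); exact: esym sE.
Qed.

End Doubling.

Lemma rank_bounded_double B : rank_bounded B -> rank_bounded (B * bool)%type.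
Proof.
move=> bdB W io y skewW ioC I J H Phi P Q E K f g N invN.
have [c [d [d0 [N' inv']]]] := doubling_minor skewW ioC invN.
have skewD := doubling_skew (ioC := ioC) skewW d0.
(* Over the cyclic algebra the point has size [B], so the induction hypothesis bounds the inner size
   [K']. Writing elements as 2 x 2 matrices over the Laurent series doubles that size. *)
have [K' [f' [g' [N'' [inv'' E'']]]]] := rank_factor skewD
  (pencil_eval (doubled_scalar ioC d) (point (doubled_point ioC y c d)) Phi).
have leK' := bdB _ _ _ skewD (doubled_scalar_central (ioC := ioC) (d := d))
  _ _ _ _ _ _ E _ _ _ _ inv''.
move: E''; set P' := (fun i l => \sum_k _); set Q' := (fun l j => _) => E''.
apply: (@leq_trans #|{: K' * bool}|).
  apply: (minor_card (laurent_skew (laurent_skew skewW))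
   (B := fun p l => qmat (P' (p.1, p.2.1) l.1) p.2.2 l.2)
   (C := fun l q => qmat (Q' l.1 (q.1, q.2.1)) l.2 q.2.2) _ inv').
  apply: matP => -[i [b e]] [j [b' e']]; rewrite doubled_pencil E'' /mulm.
  rewrite qmat_sum.
  by under eq_bigr do rewrite qmatM; rewrite pair_big.
by rewrite !card_prod card_bool mulnAC leq_mul2r leK' orbT.
Qed.

End Pencils.

(** * Kronecker products with an identity, and block triangular matrices *)

Lemma sum_prod (V : nmodType) (I J : finType) (F : I * J -> V) :
  \sum_p F p = \sum_i \sum_j F (i, j).
Proof. by rewrite pair_bigA; apply: eq_bigr => -[]. Qed.

Section MatMore.

Variable L : nzRingType.

Lemma inverse_mat_kron (I H : finType) (M N : I -> I -> L) : inverse_mat M N ->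
  inverse_mat (fun p q : I * H => (p.2 == q.2)%:R * M p.1 q.1)
    (fun p q : I * H => (p.2 == q.2)%:R * N p.1 q.1).
Proof.
have kron (A B : I -> I -> L) : mulm A B = @idm L I ->
  mulm (fun p q : I * H => (p.2 == q.2)%:R * A p.1 q.1)
    (fun p q : I * H => (p.2 == q.2)%:R * B p.1 q.1) = @idm L (I * H)%type.
  move=> AB; apply: matP => -[i h] [j h']; rewrite /mulm sum_prod exchange_big /=.
  transitivity (\sum_h0 (h == h0)%:R * ((h0 == h')%:R * mulm A B i j)).
    apply: eq_bigr => h0 _; rewrite /mulm !mulr_sumr; apply: eq_bigr => k _.
    case: (h == h0); case: (h0 == h'); rewrite /= ?(mul0r, mulr0) //.
    by rewrite !mul1r.
  rewrite sum_idl AB /idm xpair_eqE; case: (h == h'); rewrite ?mul0r ?andbF //.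
  by rewrite mul1r andbT.
by case=> MN NM; split; apply: kron.
Qed.

Lemma inverse_mat_bij (I J : finType) (phi : I -> J) (psi : J -> I)
    (M : J -> J -> L) N : cancel phi psi -> cancel psi phi ->
  inverse_mat (fun x y => M (phi x) (phi y)) N ->
  inverse_mat M (fun x y => N (psi x) (psi y)).
Proof.
move=> phiK psiK [MN NM]; split; apply: matP => i j.
  rewrite /mulm (reindex phi) /=; last by exists psi => x _.
  have /(congr1 (fun A => A (psi i) (psi j))) := MN.
  rewrite /mulm /idm (can_eq psiK) => <-.
  by apply: eq_bigr => k _; rewrite psiK phiK.
rewrite /mulm (reindex phi) /=; last by exists psi => x _.
have /(congr1 (fun A => A (psi i) (psi j))) := NM.
rewrite /mulm /idm (can_eq psiK) => <-.
by apply: eq_bigr => k _; rewrite psiK phiK.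
Qed.

Section Triangular.

Variables I J : finType.

Definition tri (P : I -> I -> L) (Q : I -> J -> L) (R : J -> J -> L) (x y : I + J) : L :=
  match x, y with
  | inl i, inl j => P i j
  | inl i, inr j => Q i j
  | inr i, inl j => 0
  | inr i, inr j => R i j
  end.

Lemma tri_mul P P' Q Q' R R' :
  mulm (tri P Q R) (tri P' Q' R') =
  tri (mulm P P') (fun i j => mulm P Q' i j + mulm Q R' i j) (mulm R R').
Proof.
apply: matP => -[i|i] [j|j]; rewrite /mulm big_sumType /=.
- by rewrite [X in _ + X]big1 ?addr0 // => k _; rewrite mulr0.
- by [].
- by rewrite !big1 ?addr0 // => k _; rewrite ?mulr0 ?mul0r.
- by rewrite [X in X + _]big1 ?add0r // => k _; rewrite mul0r.
Qed.

Lemma tri_inverse P P' Q R R' : inverse_mat P P' -> inverse_mat R R' ->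
  inverse_mat (tri P Q R) (tri P' (fun i j => - mulm (mulm P' Q) R' i j) R').
Proof.
have tri1 : tri (@idm L I) (fun _ _ => 0) (@idm L J) = @idm L (I + J)%type.
  by apply: matP => -[i|i] [j|j].
move=> [PP' P'P] [RR' R'R]; split; rewrite tri_mul ?PP' ?P'P ?RR' ?R'R -tri1;
  congr tri; apply: matP => i j.
  by rewrite mulmN /= !mulmA PP' mul1m addNr.
by rewrite mulNm /= -mulmA R'R mulm1 subrr.
Qed.

End Triangular.

End MatMore.

(** * The rank bound at matrix points of every size *)

Section RankBound.

Variables (F : numFieldType) (n : nat) (U : freeSkewField F n).

Fixpoint boolpow j : finType := if j is i.+1 then (boolpow i * bool)%type else unit.

Lemma card_boolpow j : #|boolpow j| = (2 ^ j)%N.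
Proof. by elim: j => [|j IHj]; rewrite ?card_unit // card_prod card_bool IHj expnSr. Qed.

Lemma rank_bounded_boolpow j : rank_bounded U (boolpow j).
Proof. by elim: j => [|j IHj]; [exact: rank_bounded_unit|exact: rank_bounded_double]. Qed.

Section Padding.

Variables (W : nzRingType) (io : {rmorphism F -> W}) (B C : finType) (a : nat).
Variables (e : B * 'I_a -> C) (y : 'I_n -> B -> B -> W).
Hypothesis e_inj : injective e.

(** The matrix y (x) 1_a carried to [C] by the injection [e], with zeros outside the image of
    [e]. *)
Definition padded_point (k : 'I_n) (c c' : C) : W :=
  \sum_x (c == e x)%:R * \sum_z ((x.2 == z.2)%:R * y k x.1 z.1) * (e z == c')%:R.

Lemma padded_pointE o x z : point padded_point o (e x) (e z) =
  (x.2 == z.2)%:R * point y o x.1 z.1.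
Proof.
case: o => [k|] /=; last first.
  rewrite /idm (inj_eq e_inj) -pair_eqE /pair_eq.
  by case: (x.2 == z.2); rewrite ?andbT ?andbF ?mul1r ?mul0r.
rewrite /padded_point; under eq_bigr do rewrite (inj_eq e_inj).
rewrite sum_idl; under eq_bigr do rewrite (inj_eq e_inj).
by rewrite (sum_idr (fun z => (x.2 == z.2)%:R * y k x.1 z.1)).
Qed.

Lemma padded_minor (I J K : finType) (Phi : pencil F n I J) (f : K -> I * B) (g : K -> J * B) N :
  inverse_mat (fun k l => pencil_eval io (point y) Phi (f k) (g l)) N ->
  exists N', inverse_mat (fun k l : K * 'I_a => pencil_eval io (point padded_point) Phi
     ((f k.1).1, e ((f k.1).2, k.2)) ((g l.1).1, e ((g l.1).2, l.2))) N'.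
Proof.
move/(inverse_mat_kron 'I_a) => invN.
exists (fun p q : K * 'I_a => (p.2 == q.2)%:R * N p.1 q.1); congr inverse_mat: invN.
apply: matP => k l; rewrite /pencil_eval /= mulr_sumr; apply: eq_bigr => o _.
rewrite padded_pointE /=; case: (k.2 == l.2); first by rewrite !mul1r.
by rewrite !mul0r mulr0.
Qed.

End Padding.

(* Put as many copies of [B] as possible in [boolpow j]: the room left over is
   negligible when [j] is large. *)
Theorem rank_bounded_all (B : finType) : rank_bounded U B.
Proof.
move=> W io y skewW ioC I J H Phi P Q E K f g N invN.
rewrite leqNgt; apply/negP => ltK.
have B_gt0 : (0 < #|B|)%N.
  have : (0 < #|K|)%N by apply: leq_ltn_trans ltK.
  by case/card_gt0P => k _; apply/card_gt0P; exists (f k).2.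
(* From 2^j > j one gets at least [b * r + 1] disjoint copies of [B] inside [boolpow j]. *)
pose b := #|B|; pose r := #|H|; pose j := (b * (b * r).+1)%N.
have ltj : (j < 2 ^ j)%N by rewrite ltn_expl.
pose a := (2 ^ j %/ b)%N.
have le_a : ((b * r).+1 <= a)%N by rewrite leq_divRL // mulnC ltnW.
have card_e : (#|{: B * 'I_a}| <= #|boolpow j|)%N.
  by rewrite card_prod card_ord card_boolpow mulnC leq_trunc_div.
pose e (x : B * 'I_a) : boolpow j := enum_val (widen_ord card_e (enum_rank x)).
have e_inj : injective e.
  by move=> x z /enum_val_inj/(congr1 val) /= /val_inj/enum_rank_inj.
have [N' inv'] := padded_minor e_inj invN.
have := rank_bounded_boolpow skewW ioC E inv'.
rewrite card_prod card_ord card_boolpow -/r.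
have lt2 : (2 ^ j < a.+1 * b)%N by rewrite /a ltn_ceil.
(* As [#|K|] is at least b r + 1, the inequalities a #|K| <= 2^j r <= (a + 1) b r would give a <= b
   r. *)
move: ltK; rewrite -/b -/r; nia.
Qed.

End RankBound.

(** * Linear representations *)

Section Representation.

Variables (F : numFieldType) (n : nat).

Definition tri_pencil (K1 K2 : finType) (Phi1 : pencil F n K1 K1)
    (q : K1 -> K2 -> F) (Phi2 : pencil F n K2 K2) : pencil F n (K1 + K2)%type (K1 + K2)%type :=
  fun o x y => match x, y with
  | inl i, inl j => Phi1 o i j
  | inl i, inr j => if o is None then q i j else 0
  | inr i, inl j => 0
  | inr i, inr j => Phi2 o i j
  end.

Definition border_pencil (K : finType) (Phi : pencil F n K K) (b c : K -> F) :
    pencil F n (option K) (option K) :=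
  fun o x y => match x, y with
  | Some i, Some j => Phi o i j
  | Some i, None => if o is None then b i else 0
  | None, Some j => if o is None then c j else 0
  | None, None => 0
  end.

Variables (W : nzRingType) (io : {rmorphism F -> W}) (B : finType).
Variable y : 'I_n -> B -> B -> W.

Local Notation ev := (pencil_eval io (point y)).

Definition row_mat (K : finType) (c : K -> F) : B -> K * B -> W :=
  fun i x => (i == x.2)%:R * io (c x.1).
Definition col_mat (K : finType) (b : K -> F) : K * B -> B -> W :=
  fun x i => io (b x.1) * (x.2 == i)%:R.

(** A linear representation c Phi(y)^-1 b. The data [Phi], [c], [b] are scalar and independent of
    the point, so they can be evaluated at several points. *)
Definition represents (K : finType) (Phi : pencil F n K K) (c b : K -> F)
    (m : B -> B -> W) : Prop :=
  exists2 N, inverse_mat (ev Phi) N & m = mulm (mulm (row_mat c) N) (col_mat b).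

Lemma eval_const (K1 K2 : finType) (q : K1 -> K2 -> F) x z :
  ev (fun o i j => if o is None then q i j else 0) x z =
  io (q x.1 z.1) * (x.2 == z.2)%:R.
Proof.
rewrite /pencil_eval (bigD1 None) //= big1 ?addr0 // => -[k|] // _.
by rewrite rmorph0 mul0r.
Qed.

Lemma eval0 (K1 K2 : finType) x z : ev (fun _ (i : K1) (j : K2) => 0) x z = 0.
Proof. by rewrite /pencil_eval big1 // => o _; rewrite rmorph0 mul0r. Qed.

Section Tri.

Variables (K1 K2 : finType) (Phi1 : pencil F n K1 K1) (Phi2 : pencil F n K2 K2).
Variable q : K1 -> K2 -> F.

Let phi (x : K1 * B + K2 * B) : (K1 + K2) * B :=
  match x with inl (i, b) => (inl i, b) | inr (i, b) => (inr i, b) end.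
Let psi (x : (K1 + K2) * B) : K1 * B + K2 * B :=
  match x with (inl i, b) => inl (i, b) | (inr i, b) => inr (i, b) end.

Let Q : K1 * B -> K2 * B -> W := fun x z => io (q x.1 z.1) * (x.2 == z.2)%:R.

Lemma tri_pencil_inverse N1 N2 : inverse_mat (ev Phi1) N1 -> inverse_mat (ev Phi2) N2 ->
  inverse_mat (ev (tri_pencil Phi1 q Phi2))
    (fun x z => tri N1 (fun i j => - mulm (mulm N1 Q) N2 i j) N2 (psi x) (psi z)).
Proof.
move=> inv1 inv2; apply: (@inverse_mat_bij _ _ _ phi psi); try by do 2!case.
have := tri_inverse Q inv1 inv2; congr inverse_mat.
apply: matP => -[[i b]|[i b]] [[j b']|[j b']] //=.
- by rewrite -[LHS](eval_const q (i, b) (j, b')).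
- by rewrite -[LHS](eval0 (i, b) (j, b')).
Qed.

Lemma tri_sum (G : (K1 + K2) * B -> W) :
  \sum_x G x = \sum_x G (phi (inl x)) + \sum_x G (phi (inr x)).
Proof.
rewrite (reindex phi) ?big_sumType //.
by exists psi; do 2!case.
Qed.

(** The corner - Phi1^-1 q Phi2^-1 of the inverse serves both operations: [q = 0] gives sums, and q
    = - b1 c2 with [c2] and [b1] replaced by 0 in the borders gives products. *)
Lemma represents_tri c1 b1 c2 b2 N1 N2 :
  inverse_mat (ev Phi1) N1 -> inverse_mat (ev Phi2) N2 ->
  represents (tri_pencil Phi1 q Phi2)
    (fun x => match x with inl k => c1 k | inr k => c2 k end)
    (fun x => match x with inl k => b1 k | inr k => b2 k end)
    (fun i j => mulm (mulm (row_mat c1) N1) (col_mat b1) i j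
      + mulm (mulm (row_mat c2) N2) (col_mat b2) i j
      - mulm (mulm (row_mat c1) (mulm (mulm N1 Q) N2)) (col_mat b2) i j).
Proof.
move=> inv1 inv2.
pose N x z := tri N1 (fun i j => - mulm (mulm N1 Q) N2 i j) N2 (psi x) (psi z).
exists N; [exact: tri_pencil_inverse inv1 inv2|apply: matP => i j].
rewrite [RHS]mulmE tri_sum -addrA; congr (_ + _).
  apply: eq_bigr => -[k b] _; congr (_ * _); rewrite [RHS]mulmE tri_sum /=.
  rewrite [X in _ + X]big1 ?addr0; last by case=> l b' _; rewrite /N /= mulr0.
  by apply: eq_bigr => -[l b'].
rewrite [X in X - _]mulmE [X in _ - X]mulmE -sumrB; apply: eq_bigr => -[k b] _ /=.
rewrite -mulrBl; congr (_ * _); rewrite [RHS]mulmE tri_sum /= addrC.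
by congr (_ + _); rewrite -?sumrN; apply: eq_bigr => -[l b'] _ //; rewrite /N /= mulrN.
Qed.

End Tri.

Lemma represents_add (K1 K2 : finType) Phi1 Phi2 c1 b1 c2 b2 m1 m2 :
  @represents K1 Phi1 c1 b1 m1 -> @represents K2 Phi2 c2 b2 m2 ->
  represents (tri_pencil Phi1 (fun _ _ => 0) Phi2)
    (fun x => match x with inl k => c1 k | inr k => c2 k end)
    (fun x => match x with inl k => b1 k | inr k => b2 k end)
    (fun i j => m1 i j + m2 i j).
Proof.
move=> [N1 inv1 ->] [N2 inv2 ->].
have := represents_tri (fun _ _ => 0) c1 b1 c2 b2 inv1 inv2; congr represents.
apply: matP => i j; rewrite [X in _ - X](_ : _ = 0) ?subr0 //.
rewrite /mulm big1 // => x _; rewrite big1 ?mul0r // => z _.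
by rewrite big1 ?mulr0 // => t _; rewrite big1 ?mul0r // => s _; rewrite rmorph0 mul0r mulr0.
Qed.

Lemma mul0m (I J H : finType) (A : I -> J -> W) : mulm (fun (_ : H) _ => 0) A = fun _ _ => 0.
Proof. by apply: matP => i j; rewrite /mulm big1 // => k _; rewrite mul0r. Qed.
Lemma mulm0 (I J H : finType) (A : I -> J -> W) : mulm A (fun _ (_ : H) => 0) = fun _ _ => 0.
Proof. by apply: matP => i j; rewrite /mulm big1 // => k _; rewrite mulr0. Qed.

Lemma represents_mul (K1 K2 : finType) Phi1 Phi2 c1 b1 c2 b2 m1 m2 :
  @represents K1 Phi1 c1 b1 m1 -> @represents K2 Phi2 c2 b2 m2 ->
  represents (tri_pencil Phi1 (fun i j => - (b1 i * c2 j)) Phi2)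
    (fun x => match x with inl k => c1 k | inr k => 0 end)
    (fun x => match x with inl k => 0 | inr k => b2 k end)
    (mulm m1 m2).
Proof.
move=> [N1 inv1 ->] [N2 inv2 ->].
have := represents_tri (fun i j => - (b1 i * c2 j)) c1 (fun=> 0) (fun=> 0) b2 inv1 inv2.
congr represents; apply: matP => i j.
have -> : col_mat (fun _ : K1 => 0) = fun _ _ => 0.
  by apply: matP => x k; rewrite /col_mat rmorph0 mul0r.
have -> : row_mat (fun _ : K2 => 0) = fun _ _ => 0.
  by apply: matP => x k; rewrite /row_mat rmorph0 mulr0.
rewrite mulm0 !mul0m addr0 add0r.
have -> : (fun x z => io (- (b1 x.1 * c2 z.1)) * (x.2 == z.2)%:R) =
   (fun x z => - mulm (col_mat b1) (row_mat c2) x z).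
  apply: matP => -[k b] [l b']; rewrite /mulm /col_mat /row_mat /=.
  under [in RHS]eq_bigr do rewrite -mulrA.
  rewrite -mulr_sumr sum_idl rmorphN rmorphM mulNr -mulrA; congr (- (_ * _)).
  by case: eqP; rewrite ?mulr1 ?mulr0 ?mul1r ?mul0r.
by rewrite mulmN mulNm mulmN mulNm opprK !mulmA.
Qed.

(** The pencil [1, -phi; 0, 1] has the inverse [1, phi; 0, 1]. *)
Lemma represents_affine (phi : option 'I_n -> F) :
  represents (fun o (i j : bool) => match i, j with
      | false, true => - phi o
      | true, false => 0
      | _, _ => (o == None)%:R
      end) (fun i => (~~ i)%:R) (fun i => i%:R)
    (fun i j => \sum_o io (phi o) * point y o i j).
Proof.
pose m i j := \sum_o io (phi o) * point y o i j.
(* [T true] is the pencil at [y] and [T false] its inverse. *)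
pose T (e : bool) (x z : bool * B) : W := match x.1, z.1 with
   | false, true => (-1) ^+ e * m x.2 z.2 | true, false => 0 | _, _ => (x.2 == z.2)%:R end.
have evT : ev (fun o (i j : bool) => match i, j with
      | false, true => - phi o
      | true, false => 0
      | _, _ => (o == None)%:R
      end) = T true.
  apply: matP => -[i b] [j b'].
  have diag : \sum_o io (o == None)%:R * point y o b b' = (b == b')%:R.
    rewrite (bigD1 None) //= rmorph1 mul1r big1 ?addr0 // => -[k|] // _.
    by rewrite rmorph0 mul0r.
  case: i j => [|] [|]; rewrite /pencil_eval /T /=.
  - exact: diag.
  - by rewrite big1 // => o _; rewrite rmorph0 mul0r.
  - rewrite expr1 mulN1r /m -sumrN; apply: eq_bigr => o _.
    by rewrite rmorphN mulNr.
  - exact: diag.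
have TT e : mulm (T e) (T (~~ e)) = @idm W (bool * B)%type.
  apply: matP => -[i b] [j b']; rewrite /mulm sum_prod big_bool /T /idm xpair_eqE /=.
  case: i j => [|] [|] /=; rewrite ?(sum_idl, sum_idr).
  - by rewrite [X in _ + X]big1 ?addr0 // => k _; rewrite mul0r.
  - by rewrite addr0.
  - by case: e; rewrite /= expr0 expr1 mulN1r mul1r ?addNr ?subrr.
  - by rewrite [X in X + _]big1 ?add0r // => k _; rewrite mulr0.
exists (T false); first by rewrite evT; split; [exact: TT|exact: (TT false)].
apply: matP => i j; rewrite /mulm sum_prod big_bool /=.
rewrite [X in _ + X]big1 ?addr0; last first.
  by move=> k _; rewrite /col_mat /= rmorph0 mul0r mulr0.
under [RHS]eq_bigr do rewrite /col_mat /= rmorph1 mul1r.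
rewrite sum_idr sum_prod big_bool /= [X in X + _]big1 ?add0r; last first.
  by move=> k _; rewrite /row_mat /= rmorph0 mulr0 mul0r.
under [RHS]eq_bigr do rewrite /row_mat /= rmorph1 mulr1.
by rewrite sum_idl /T expr0 mul1r.
Qed.

(** By the Schur complement, the corner of the inverse of [Phi, b; c, 0] is - (c Phi^-1 b)^-1: this
    is how inverses are represented. *)
Lemma represents_border (K : finType) (Phi : pencil F n K K) c b N :
  inverse_mat (ev (border_pencil Phi b c)) N ->
  represents (border_pencil Phi b c) (fun o => if o is None then -1 else 0)
    (fun o => if o is None then 1 else 0) (fun i j => - N (None, i) (None, j)).
Proof.
move=> invN; exists N => //; apply: matP => i j; rewrite /mulm sum_prod big_option.
rewrite [X in _ + X]big1 ?addr0; last first.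
  by move=> k _; rewrite big1 // => b' _; rewrite /col_mat /= rmorph0 mul0r mulr0.
under eq_bigr do rewrite /col_mat /= rmorph1 mul1r.
rewrite sum_idr sum_prod big_option [X in _ + X]big1 ?addr0; last first.
  by move=> k _; rewrite big1 // => b' _; rewrite /row_mat /= rmorph0 mulr0 mul0r.
under eq_bigr do rewrite /row_mat /= rmorphN1 mulrN1 mulNr.
by rewrite sumrN sum_idl.
Qed.

End Representation.

(** * The ring morphism that extends x |-> y *)

Section MatrixHom.

Variables (F : numFieldType) (n : nat) (U : freeSkewField F n).
Variables (W : unitRingType) (io : {rmorphism F -> W}) (B : finType).
Variable y : 'I_n -> B -> B -> W.
Hypothesis skewW : GRing.field_axiom W.
Hypothesis ioC : forall r, central (io r).
Hypothesis y_generic : forall (I : finType) (Phi : pencil F n I I) N,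
  inverse_mat (pencil_gen U Phi) N ->
  exists N', inverse_mat (pencil_eval io (point y) Phi) N'.

Let iU : {rmorphism F -> U} := @GRing.in_alg F U.
Let yU (k : 'I_n) (_ _ : unit) : U := gen U k.
Let skewU : GRing.field_axiom U := free_skew_field_skew U.

Lemma eval_gen (I J : finType) (Phi : pencil F n I J) x z :
  pencil_eval iU (point yU) Phi x z = pencil_gen U Phi x.1 z.1.
Proof.
case: x z => [i []] [j []]; by apply: eq_bigr => -[k|] _.
Qed.

Lemma sum_unit (V : nmodType) (I : finType) (G : I * unit -> V) :
  \sum_x G x = \sum_i G (i, tt).
Proof.
rewrite sum_prod; apply: eq_bigr => i _.
by rewrite (big_pred1 tt) // => -[].
Qed.

Lemma eval_gen_inverse (I : finType) (Phi : pencil F n I I) N :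
  inverse_mat (pencil_eval iU (point yU) Phi) N <->
  (inverse_mat (pencil_gen U Phi) (fun i j => N (i, tt) (j, tt))).
Proof.
have E1 x z : mulm (pencil_eval iU (point yU) Phi) N x z =
   mulm (pencil_gen U Phi) (fun i j => N (i, tt) (j, tt)) x.1 z.1.
  case: x z => [i []] [j []]; rewrite mulmE sum_unit; apply: eq_bigr => k _.
  by rewrite eval_gen.
have E2 x z : mulm N (pencil_eval iU (point yU) Phi) x z =
   mulm (fun i j => N (i, tt) (j, tt)) (pencil_gen U Phi) x.1 z.1.
  case: x z => [i []] [j []]; rewrite mulmE sum_unit; apply: eq_bigr => k _.
  by rewrite eval_gen.
split=> -[E3 E4]; split; apply: matP.
- by move=> i j; rewrite -(E1 (i, tt) (j, tt)) E3 /idm xpair_eqE andbT.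
- by move=> i j; rewrite -(E2 (i, tt) (j, tt)) E4 /idm xpair_eqE andbT.
- by move=> [i []] [j []]; rewrite E1 E3 /idm xpair_eqE andbT.
- by move=> [i []] [j []]; rewrite E2 E4 /idm xpair_eqE andbT.
Qed.

Lemma gen_const (I J : finType) (q : I -> J -> F) i j :
  pencil_gen U (fun o i j => if o is None then q i j else 0) i j = (q i j)%:A.
Proof.
rewrite /pencil_gen (bigD1 None) //= mulr1 big1 ?addr0 // => -[k|] // _.
by rewrite scale0r mul0r.
Qed.

Lemma gen_border (K : finType) (Phi : pencil F n K K) (b c : K -> F) :
  pencil_gen U (border_pencil Phi b c) =
  border (pencil_gen U Phi) (fun k => (b k)%:A) (fun k => (c k)%:A) 0.
Proof.
apply: matP => -[i|] [j|] //=.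
- by rewrite -[RHS](gen_const (fun i (_ : unit) => b i) i tt).
- by rewrite -[RHS](gen_const (fun (_ : unit) j => c j) tt j).
- by rewrite -(scale0r (1 : U)) -[RHS](gen_const (fun (_ _ : unit) => 0) tt tt);
    apply: eq_bigr => -[].
Qed.

(** The future graph of the morphism: [graph0] makes it single-valued, and [graphV] carries totality
    through inverses. *)
Definition graph (a : U) (m : B -> B -> W) : Prop :=
  exists (K : finType) (Phi : pencil F n K K) c b,
    represents iU yU Phi c b (fun _ _ => a) /\ represents io y Phi c b m.

Lemma represents_gen (K : finType) (Phi : pencil F n K K) c b a :
  represents iU yU Phi c b (fun _ _ => a) ->
  exists2 N, inverse_mat (pencil_gen U Phi) N &
    a = \sum_k \sum_l (c k)%:A * N k l * (b l)%:A.
Proof.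
case=> N /eval_gen_inverse invN aE; eexists; first exact: invN.
rewrite [LHS](congr1 (fun M => M tt tt) aE) mulmE sum_unit exchange_big; apply: eq_bigr => l _.
rewrite mulmE sum_unit -mulr_suml; congr (_ * _); last by rewrite /col_mat /= mulr1.
by apply: eq_bigr => k _; rewrite /row_mat /= mul1r.
Qed.

Lemma graph0 m : graph 0 m -> m = fun _ _ => 0.
Proof.
move=> [K [Phi [c [b [/represents_gen[N invN cNb] [N' invN' mE]]]]]].
apply: matP => i j; apply/eqP/negPn/negP => mij.
(* The bordered matrix [Phi, b; c, 0] is the product [Phi; c] [1, Phi^-1 b], because c Phi^-1 b is
   0. *)
pose P (o : option K) (k : K) : U :=
  if o is Some i then pencil_gen U Phi i k else (c k)%:A.
pose Q (k : K) (o : option K) : U :=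
  if o is Some j then (k == j)%:R else \sum_l N k l * (b l)%:A.
have genE : pencil_gen U (border_pencil Phi b c) = mulm P Q.
  rewrite gen_border; apply: matP => o o'; rewrite mulmE.
  case: o' => [l|] /=; first by rewrite sum_idr; case: o.
  under eq_bigr do rewrite mulr_sumr.
  case: o => [k|] /=; last first.
    by rewrite [LHS]cNb; apply: eq_bigr => k _; apply: eq_bigr => l _; rewrite mulrA.
  rewrite exchange_big /=.
  under eq_bigr do under eq_bigr do rewrite mulrA.
  under eq_bigr do rewrite -mulr_suml -mulmE invN.1.
  by rewrite /idm sum_idl.
(* Of the border blocks only the row [i] and the column [j] are kept, so the minor has size
   [#|K| * #|B| + 1]. *)
pose f (i0 : B) (x : option (K * B)) : option K * B :=
  if x is Some z then (Some z.1, z.2) else (None, i0).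
have evE : border (pencil_eval io (point y) Phi) (fun x => col_mat io b x j)
    (fun x => row_mat io c i x) 0 =
    fun x z => pencil_eval io (point y) (border_pencil Phi b c) (f i x) (f j z).
  apply: matP => -[[k b1]|] [[l b2]|] //=.
  - by rewrite -[LHS](eval_const io y (fun k (_ : unit) => b k) (k, b1) (tt, j)).
  - transitivity (io (c l) * (i == b2)%:R).
      by rewrite /row_mat /=; case: (i == b2); rewrite ?mul1r ?mulr1 ?mul0r ?mulr0.
    exact: esym (eval_const io y (fun (_ : unit) l => c l) (tt, i) (l, b2)).
  - rewrite -[LHS](@eval0 F n W io B y unit unit (tt, i) (tt, j)).
    by apply: eq_bigr => -[].
have mE' : \sum_x \sum_z row_mat io c i x * N' x z * col_mat io b z j = m i j.
  rewrite mE [RHS]mulmE exchange_big; apply: eq_bigr => z _.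
  by rewrite mulmE mulr_suml.
have Um := skewW mij.
have ts : - (m i j)^-1 * (0 - \sum_x \sum_z row_mat io c i x * N' x z * col_mat io b z j) = 1.
  by rewrite mE' sub0r mulrNN mulVr.
have st : (0 - \sum_x \sum_z row_mat io c i x * N' x z * col_mat io b z j) * - (m i j)^-1 = 1.
  by rewrite mE' sub0r mulrNN mulrV.
have inv := border_inverse (b := fun x => col_mat io b x j)
  (c := fun x => row_mat io c i x) invN' ts st.
rewrite evE in inv; have := rank_bounded_all skewW ioC genE inv.
by rewrite card_option card_prod mulnC ltnn.
Qed.

Lemma graph_affine (phi : option 'I_n -> F) :
  graph (\sum_o (phi o)%:A * oapp (gen U) 1 o)
    (fun i j => \sum_o io (phi o) * point y o i j).
Proof.
have := represents_affine iU yU phi; have := represents_affine io y phi.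
set Phi := (fun o i j => _) => repW repU; exists bool, Phi; do 2!eexists; split; last exact: repW.
congr represents: repU; apply: matP => -[] []; apply: eq_bigr => -[k|] _ //=.
Qed.

Lemma graph_scalar r : graph r%:A (fun i j => io r * (i == j)%:R).
Proof.
have := graph_affine (fun o => if o is None then r else 0); congr graph.
  rewrite (bigD1 None) //= mulr1 big1 ?addr0 // => -[k|] // _.
  by rewrite scale0r mul0r.
apply: matP => i j.
rewrite (bigD1 None) //= big1 ?addr0 // => -[k|] // _.
by rewrite rmorph0 mul0r.
Qed.

Lemma graph_gen k : graph (gen U k) (y k).
Proof.
have := graph_affine (fun o => (o == Some k)%:R); congr graph.
  rewrite (bigD1 (Some k)) //= eqxx scale1r mul1r big1 ?addr0 // => o /negPf ->.
  by rewrite scale0r mul0r.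
apply: matP => i j.
rewrite (bigD1 (Some k)) //= eqxx rmorph1 mul1r big1 ?addr0 // => o /negPf ->.
by rewrite rmorph0 mul0r.
Qed.

Lemma graphD a b m p : graph a m -> graph b p -> graph (a + b) (fun i j => m i j + p i j).
Proof.
move=> [K [Phi [c [d [repU repW]]]]] [K' [Phi' [c' [d' [repU' repW']]]]].
do 4!eexists; split; first exact: represents_add repU repU'.
exact: represents_add repW repW'.
Qed.

Lemma graphM a b m p : graph a m -> graph b p -> graph (a * b) (mulm m p).
Proof.
move=> [K [Phi [c [d [repU repW]]]]] [K' [Phi' [c' [d' [repU' repW']]]]].
have -> : a * b = mulm (fun _ _ : unit => a) (fun _ _ : unit => b) tt tt.
  by rewrite mulmE (big_pred1 tt) // => -[].
do 4!eexists; split; last exact: represents_mul repW repW'.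
have := represents_mul repU repU'; congr represents.
Qed.

Lemma graphB a b m p : graph a m -> graph b p -> graph (a - b) (fun i j => m i j - p i j).
Proof.
move=> am bp; have := graphD am (graphM (graph_scalar (-1)) bp); congr graph.
  by rewrite scaleN1r mulN1r.
apply: matP => i j; congr (_ + _); rewrite mulmE.
under eq_bigr do rewrite rmorphN1 mulN1r mulNr.
by rewrite sumrN sum_idl.
Qed.

Lemma graph_inj a m p : graph a m -> graph a p -> m = p.
Proof.
move=> am ap; have := graphB am ap; rewrite subrr => /graph0 mp.
apply: matP => i j; apply/eqP; rewrite -subr_eq0.
by have /(congr1 (fun M => M i j)) /= -> := mp.
Qed.

(** For nonzero [a] the bordered pencil is invertible over [U], hence at [y] by [y_generic]; its
    corner there gives the matrix related to the inverse. *)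
Lemma graphV a m : graph a m -> a != 0 -> exists m', graph a^-1 m'.
Proof.
move=> [K [Phi [c [b [/represents_gen[N invN aE] repW]]]]] a0.
have Ua := skewU a0.
have ts : - a^-1 * (0 - \sum_k \sum_l (c k)%:A * N k l * (b l)%:A) = 1.
  by rewrite -aE sub0r mulrNN mulVr.
have st : (0 - \sum_k \sum_l (c k)%:A * N k l * (b l)%:A) * - a^-1 = 1.
  by rewrite -aE sub0r mulrNN mulrV.
have invB := border_inverse (b := fun l => (b l)%:A) (c := fun k => (c k)%:A) invN ts st.
rewrite -gen_border in invB; have [N' invN'] := y_generic invB.
eexists; do 4!eexists; split; last exact: represents_border invN'.
set Nb := border_inv _ _ _ _ in invB.
have invU : inverse_mat (pencil_eval iU (point yU) (border_pencil Phi b c))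
    (fun x z => Nb x.1 z.1) by apply/eval_gen_inverse.
have := represents_border invU; congr represents.
by apply: matP => -[] []; rewrite /= opprK.
Qed.

Lemma graph_total a : exists m, graph a m.
Proof.
pose S : {pred U} := [pred a | `[< exists m, graph a m >]].
suff: a \in S by move/asboolP.
have inS u : u \in S -> exists m, graph u m by move/asboolP.
have Sscal r : r%:A \in S by apply/asboolP; eexists; exact: graph_scalar.
apply: free_skew_field_gen => // [|k]; last first.
  by apply/asboolP; eexists; exact: graph_gen.
split=> [|u v /inS[m um] /inS[p vp]|u v /inS[m um] /inS[p vp]].
- by rewrite -[1]scale1r.
- by apply/asboolP; eexists; exact: graphB um vp.
have [->|v0] := eqVneq v 0; first by rewrite invr0 mulr0 -(scale0r (1 : U)).
have [q vq] := graphV vp v0.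
by apply/asboolP; eexists; exact: graphM um vq.
Qed.

Theorem matrix_hom : exists h : U -> B -> B -> W,
  [/\ forall r, h r%:A = fun i j => io r * (i == j)%:R,
      forall k, h (gen U k) = y k,
      forall a b, h (a - b) = fun i j => h a i j - h b i j
    & forall a b, h (a * b) = mulm (h a) (h b)].
Proof.
have [h hP] := choice graph_total; exists h; split.
- by move=> r; apply: graph_inj (hP _) (graph_scalar r).
- by move=> k; apply: graph_inj (hP _) (graph_gen k).
- by move=> a b; apply: graph_inj (hP _) (graphB (hP a) (hP b)).
- by move=> a b; apply: graph_inj (hP _) (graphM (hP a) (hP b)).
Qed.

End MatrixHom.

(** * Linear group actions *)

Section Avoid.

Variable F : numFieldType.

Lemma poly_nonroot (p : {poly F}) : p != 0 -> exists x, p.[x] != 0.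
Proof.
move=> p0; apply: contrapT => proot.
have := max_poly_roots p0 (rs := [seq k%:R | k <- iota 0 (size p)]).
rewrite size_map size_iota ltnn => H; suff: false by []; apply: H.
  apply/allP => _ /mapP[k _ ->]; apply/rootP/eqP/negPn/negP => pk.
  by apply: proot; exists k%:R.
rewrite map_inj_uniq ?iota_uniq // => i j /eqP.
by rewrite eqr_nat => /eqP.
Qed.

(* A suitable point of the moment curve (1, x, x^2, ...) avoids finitely many
   hyperplanes. *)
Lemma avoid_hyperplanes n (T : finType) (u : T -> 'rV[F]_n.+1) :
  (forall t, u t != 0) ->
  exists c : 'cV[F]_n.+1, c 0 0 = 1 /\ forall t, (u t *m c) 0 0 != 0.
Proof.
move=> u0; have [|x px] := @poly_nonroot (\prod_t rVpoly (u t)).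
  apply/prodf_neq0 => t _; apply: contraNneq (u0 t) => ut0.
  by rewrite -[u t]rVpolyK ut0 linear0.
exists (\col_i x ^+ i); split=> [|t]; first by rewrite mxE.
move: px; rewrite horner_prod => /prodf_neq0/(_ t isT); apply: contraNneq => ut0.
apply/eqP; rewrite /rVpoly horner_poly -[RHS]ut0 mxE; apply: eq_bigr => i _.
by rewrite valK mxE.
Qed.

Variables (n : nat) (G : finGroupType) (rho : G -> 'M[F]_n.+1).
Hypothesis rho_inj : forall g, rho g = 1%:M -> g = 1%g.

(** For [g] other than 1, some row of [rho g - 1] is nonzero, and it vanishes on all vectors fixed
    by [g]. The normalization [l 0 0 = 1] lets [l] replace the first variable in a basis. *)
Lemma generic_vector : exists l : 'cV[F]_n.+1, l 0 0 = 1 /\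
  forall g, g != 1%g -> rho g *m l != l.
Proof.
have ex_row (g : G) : exists u : 'rV[F]_n.+1, u != 0 /\
    forall l : 'cV_n.+1, g != 1%g -> (u *m l) 0 0 != 0 -> rho g *m l != l.
  have [->|g1] := eqVneq g 1%g.
    exists (const_mx 1); split=> //; apply/eqP => /matrixP/(_ 0 0)/eqP.
    by rewrite !mxE oner_eq0.
  have /eqP/matrix0Pn[i [j gij]] : rho g - 1%:M <> 0.
    by move/eqP; rewrite subr_eq0 => /eqP/rho_inj/eqP; rewrite (negPf g1).
  exists (row i (rho g - 1%:M)); split=> [|l _].
    by apply/eqP => /matrixP/(_ 0 j)/eqP; rewrite !mxE; apply/negP; rewrite !mxE in gij.
  apply: contraNneq => gl.
  by rewrite -row_mul mulmxBl mul1mx gl subrr row0 mxE.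
have [u uP] := choice ex_row.
have [|l [l0 lP]] := @avoid_hyperplanes n G u; first by move=> g; case: (uP g).
exists l; split=> // g g1; have [_ H] := uP g; exact: H.
Qed.

(** Provides a point where 1 - l vanishes and its other translates do not. *)
Lemma generic_functional (l : 'cV[F]_n.+1) : l 0 0 = 1 ->
  (forall g, g != 1%g -> rho g *m l != l) ->
  exists p : 'rV[F]_n.+1, (p *m l) 0 0 = 1 /\
    forall g, g != 1%g -> (p *m (rho g *m l)) 0 0 != 1.
Proof.
(* The row at [g = 1] ensures c^T l <> 0, so that c can be scaled to take the value 1 at [l]. *)
move=> l0 lP; pose u (g : G) : 'rV[F]_n.+1 :=
  if g == 1%g then l^T else (rho g *m l - l)^T.
have [g|c [_ cP]] := @avoid_hyperplanes n G u.
  rewrite /u; have [_|g1] := eqVneq g 1%g.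
    by apply/eqP => /matrixP/(_ 0 0)/eqP; rewrite !mxE l0 oner_eq0.
  by rewrite trmx_eq0 subr_eq0 lP.
have trE (v : 'cV[F]_n.+1) : (v^T *m c) 0 0 = (c^T *m v) 0 0.
  by rewrite -[c in LHS]trmxK -trmx_mul mxE.
have cl : (c^T *m l) 0 0 != 0 by have := cP 1%g; rewrite /u eqxx trE.
exists (((c^T *m l) 0 0)^-1 *: c^T); split=> [|g g1].
  by rewrite -scalemxAl mxE mulVf.
rewrite -scalemxAl; have := cP g; rewrite /u (negPf g1) trE mulmxBr.
move: cl; move: (c^T *m l) (c^T *m (rho g *m l)) => d a d0; rewrite !mxE subr_eq0.
by apply: contraNneq => E; rewrite -[a 0 0](mulVKf d0) E mulr1.
Qed.

End Avoid.

Lemma colvec_linear_ext (F : fieldType) (n : nat) (L : lmodType F) (f f' : 'cV[F]_n -> L) :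
  (forall r u v, f (r *: u + v) = r *: f u + f v) ->
  (forall r u v, f' (r *: u + v) = r *: f' u + f' v) ->
  (forall k, f (delta_mx k 0) = f' (delta_mx k 0)) -> f =1 f'.
Proof.
move=> fP f'P ff' v.
have fsum (e : 'cV[F]_n -> L) : (forall r u v, e (r *: u + v) = r *: e u + e v) ->
    e v = \sum_i v i 0 *: e (delta_mx i 0).
  move=> eP; transitivity (e (\sum_i v i 0 *: delta_mx i 0)).
    congr e; apply/colP => i; rewrite summxE (bigD1 i) //= !mxE !eqxx mulr1.
    by rewrite big1 ?addr0 // => j ji; rewrite !mxE eq_sym (negPf ji) mulr0.
  elim/big_rec2: _ => [|i x y _ <-]; last by rewrite eP.
  by have := eP (-1) 0 0; rewrite scaler0 addr0 scaleN1r addNr.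
by rewrite (fsum f) // (fsum f') //; apply: eq_bigr => i _; rewrite ff'.
Qed.

(** * Right multiplications in a basis permuted by the group *)

Section NormalForm.

Variables (F : numFieldType) (n : nat) (G : finGroupType).
Variables (rho : G -> 'M[F]_n.+1) (l : 'cV[F]_n.+1).
Hypothesis l0 : l 0 0 = 1.
Hypothesis rhoM : forall g h, rho (g * h)%g = rho g *m rho h.
Hypothesis rho1 : rho 1%g = 1%:M.

Section Coefficient.

Variables (L : unitAlgType F) (q : option (G * 'I_n) -> L).

(** The linear map in [v] with prescribed values on l, e_1, ..., e_n, a basis because [l 0 0 = 1].
    It stands for the coefficient of p_a (a v) at p_1: on [l] it is imposed by p_a (a l) = p_a - 1,
    on the e_k it is a free parameter. *)
Definition coefficient (a : G) (v : 'cV[F]_n.+1) : L :=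
  v 0 0 *: ((a == 1%g)%:R - q None) +
  \sum_k (v (lift ord0 k) 0 - v 0 0 * l (lift ord0 k) 0) *: q (Some (a, k)).

Lemma coefficientP a r u v :
  coefficient a (r *: u + v) = r *: coefficient a u + coefficient a v.
Proof.
rewrite /coefficient !mxE (scalerDr r) scaler_sumr addrACA -big_split /=.
rewrite scalerA -scalerDl; congr (_ + _); apply: eq_bigr => k _.
by rewrite !mxE scalerA -scalerDl mulrBr mulrDl opprD addrACA mulrA.
Qed.

Lemma coefficient_l a : coefficient a l = (a == 1%g)%:R - q None.
Proof.
rewrite /coefficient l0 scale1r big1 ?addr0 // => k _.
by rewrite mul1r subrr scale0r.
Qed.

Lemma coefficient_delta a k : coefficient a (delta_mx (lift ord0 k) 0) = q (Some (a, k)).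
Proof.
rewrite /coefficient !mxE /= scale0r add0r (bigD1 k) //= !mxE !eqxx mul0r subr0 scale1r.
rewrite big1 ?addr0 // => i ik; rewrite !mxE (inj_eq lift_inj) (negPf ik) /=.
by rewrite mul0r subr0 scale0r.
Qed.

Lemma coefficient_unique a (f : 'cV[F]_n.+1 -> L) :
  (forall r u v, f (r *: u + v) = r *: f u + f v) ->
  f l = (a == 1%g)%:R - q None ->
  (forall k, f (delta_mx (lift ord0 k) 0) = q (Some (a, k))) ->
  f =1 coefficient a.
Proof.
move=> fP fl fd v.
have fsum (f' : 'cV[F]_n.+1 -> L) (s : 'I_n -> F) (u : 'I_n -> 'cV[F]_n.+1) :
    (forall r u v, f' (r *: u + v) = r *: f' u + f' v) ->
    f' (\sum_i s i *: u i) = \sum_i s i *: f' (u i).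
  move=> f'P; elim/big_rec2: _ => [|i x y _ <-]; last by rewrite f'P.
  by have := f'P (-1) 0 0; rewrite scaler0 addr0 scaleN1r addNr.
have -> : v = v 0 0 *: l +
    \sum_k (v (lift ord0 k) 0 - v 0 0 * l (lift ord0 k) 0) *: delta_mx (lift ord0 k) 0.
  apply/colP => i; rewrite !mxE summxE.
  have [->|[k ->]] : i = ord0 \/ exists k, i = lift ord0 k.
    by case: (unliftP ord0 i) => [k ->|->]; [right; exists k|left].
    rewrite l0 mulr1 big1 ?addr0 // => k _; rewrite !mxE /=.
    by rewrite mulr0.
  rewrite (bigD1 k) //= big1 => [|j jk]; last first.
    by rewrite !mxE (inj_eq lift_inj) eq_sym (negPf jk) mulr0.
  by rewrite !mxE !eqxx mulr1 addr0 addrC subrK.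
rewrite fP (fsum f) // coefficientP (fsum (coefficient a)); last exact: coefficientP.
rewrite fl coefficient_l; congr (_ + _); apply: eq_bigr => k _.
by rewrite fd coefficient_delta.
Qed.

(* The matrix of the right multiplication by [v] in a basis [p_b] permuted by the
   group such that [p_b (1 - b l) = 1], when [q None] is the coefficient of 1 at
   [p_1] and [q (Some (a, k))] that of [p_a (a x_k)]. *)
Definition normal_form (v : 'cV[F]_n.+1) (b c : G) : L :=
  coefficient (c^-1 * b)%g (rho b^-1%g *m v).

Lemma normal_formP r u v b c :
  normal_form (r *: u + v) b c = r *: normal_form u b c + normal_form v b c.
Proof. by rewrite /normal_form mulmxDr -scalemxAr coefficientP. Qed.

Lemma normal_form_equivariant g v b c :
  normal_form (rho g *m v) b c = normal_form v (g^-1 * b)%g (g^-1 * c)%g.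
Proof.
rewrite /normal_form mulmxA -rhoM !invMg invgK mulgA.
by rewrite -[(c^-1 * g * g^-1)%g]mulgA mulgV mulg1.
Qed.

End Coefficient.

End NormalForm.

(** * The basis of resolvents and the map from the invariants *)

Section GroupAction.

Variables (F : numFieldType) (n : nat) (G : finGroupType) (U : freeSkewField F n.+1).
Variables (act : G -> {lrmorphism U -> U}) (rho : G -> 'M[F]_n.+1).
Hypothesis act1 : act 1%g =1 id.
Hypothesis actM : forall g h u, act (g * h)%g u = act g (act h u).
Hypothesis act_gen : forall g j, act g (gen U j) = \sum_i rho g i j *: gen U i.
Hypothesis rho1 : rho 1%g = 1%:M.
Hypothesis rhoM : forall g h, rho (g * h)%g = rho g *m rho h.
Variables (l : 'cV[F]_n.+1) (pt : 'rV[F]_n.+1).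
Hypothesis l0 : l 0 0 = 1.
Hypothesis pt_l : (pt *m l) 0 0 = 1.
Hypothesis pt_rho : forall g, g != 1%g -> (pt *m (rho g *m l)) 0 0 != 1.

Let skewU : GRing.field_axiom U := free_skew_field_skew U.

Definition lin (v : 'cV[F]_n.+1) : U := \sum_i v i 0 *: gen U i.

Lemma linP r u v : lin (r *: u + v) = r *: lin u + lin v.
Proof.
rewrite /lin scaler_sumr -big_split; apply: eq_bigr => i _.
by rewrite !mxE scalerDl scalerA.
Qed.

Lemma lin_delta k : lin (delta_mx k 0) = gen U k.
Proof.
rewrite /lin (bigD1 k) //= mxE !eqxx scale1r big1 ?addr0 // => i ik.
by rewrite mxE (negPf ik) scale0r.
Qed.

Lemma act_lin g v : act g (lin v) = lin (rho g *m v).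
Proof.
rewrite /lin linear_sum /=.
under eq_bigr do rewrite linearZ /= act_gen scaler_sumr.
rewrite exchange_big; apply: eq_bigr => i _ /=.
rewrite mxE scaler_suml; apply: eq_bigr => k _.
by rewrite scalerA mulrC.
Qed.

Definition resolvent (b : G) : U := (1 - lin (rho b *m l))^-1.

(** Used at the point 0, where every 1 - v takes the value 1 and is therefore a unit, and at [pt],
    to prove that the resolvents are independent. *)
Lemma point_eval (p : 'rV[F]_n.+1) : exists (S : {pred U}) (h : U -> F),
    [/\ subring_closed S,
        {in S &, {morph h : a b / a - b}} /\ {in S &, {morph h : a b / a * b}},
        forall v, 1 - lin v \in S /\ h (1 - lin v) = 1 - (p *m v) 0 0
      & {in S, forall a, h a != 0 -> a^-1 \in S}].
Proof.
have skewF : skew_field F by move=> x; rewrite unitfE.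
have ioC (r : F) : central (@idfun F r) by move=> x; rewrite mulrC.
have [S [h [[Ssub SF Sx] [hB hM] [hF hx] hV]]] :=
  universal_eval U (io := idfun) (fun i => p 0 i) skewF ioC.
have [S1 SB SM] := Ssub.
have h1 : h 1 = 1 by rewrite -[1]scale1r hF.
exists S, h; split=> // v.
have [|Sl hl] := @subring_morph_sum _ _ S h Ssub hB _ (fun i => v i 0 *: gen U i).
  by move=> i; rewrite -mulr_algl SM.
split; first exact: SB.
rewrite hB // h1 hl mxE; congr (_ - _); apply: eq_bigr => i _.
by rewrite -mulr_algl hM // hF hx mulrC.
Qed.

Lemma one_sub_lin_unit v : 1 - lin v \is a GRing.unit.
Proof.
have [S [h [Ssub [hB hM] hl hV]]] := point_eval 0.
apply/skewU; apply/eqP => v0; have [Sv] := hl v.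
have h0 : h 0 = 0.
  by have [S1 _ _] := Ssub; rewrite -(subrr 1) hB ?subrr.
by rewrite v0 h0 mul0mx mxE subr0 => /esym/eqP; rewrite oner_eq0.
Qed.

Lemma act_resolvent g b : act g (resolvent b) = resolvent (g * b)%g.
Proof.
rewrite /resolvent rmorphV ?one_sub_lin_unit //= rmorphB rmorph1 /= act_lin.
by rewrite mulmxA -rhoM.
Qed.

Lemma resolvent_mul b : resolvent b * (1 - lin (rho b *m l)) = 1.
Proof. by rewrite /resolvent mulVr ?one_sub_lin_unit. Qed.

Let Gamma (b g : G) : U := resolvent (g * b)%g.

(* After multiplication by [1 - lin l], Gamma specializes at [pt] to a
   permutation matrix. *)
Lemma Gamma_inverse : exists N, inverse_mat Gamma N.
Proof.
have [S [h [Ssub [hB hM] hl hV]]] := point_eval pt.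
have [S1 SB SM] := Ssub; pose u := 1 - lin l.
have h0 : h 0 = 0 by rewrite -(subrr 1) hB ?subrr.
have [Su hu] : u \in S /\ h u = 0.
  by have [Su ->] := hl l; rewrite pt_l subrr.
have h1 : h 1 = 1.
  have [S1' h1] := hl 0; rewrite mulmx0 mxE subr0 in h1.
  by rewrite -{1}[1]subr0 -[X in _ - X](_ : lin 0 = 0) // /lin big1 // => i _; rewrite mxE scale0r.
(* [u] vanishes at [pt], where [resolvent g] is defined for [g] other than 1; for [g = 1] the
   product is 1. *)
have u_resolventE g : u * resolvent g \in S /\ h (u * resolvent g) = (g == 1%g)%:R.
  have [->|g1] := eqVneq g 1%g.
    by rewrite /resolvent rho1 mul1mx mulrV ?one_sub_lin_unit.
  have [Sg hg] := hl (rho g *m l).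
  have Spp : resolvent g \in S by apply: hV => //; rewrite hg subr_eq0 eq_sym pt_rho.
  by rewrite SM // hM // hu mul0r.
have sumT (b c : G) : \sum_g (g * b == 1)%g%:R * (g * c == 1)%g%:R = (b == c)%:R :> F.
  rewrite (bigD1 b^-1)%g //= mulVg eqxx mul1r -(inj_eq (mulgI b)) mulKVg mulg1 eq_sym.
  rewrite big1 ?addr0 // => g gb; rewrite -(inj_eq (mulIg b^-1%g)) mulgK mul1g.
  by rewrite (negPf gb) mul0r.
have sumT' (g k : G) : \sum_b (g * b == 1)%g%:R * (k * b == 1)%g%:R = (g == k)%:R :> F.
  rewrite (bigD1 g^-1)%g //= mulgV eqxx mul1r -(inj_eq (mulIg g)) mulgKV mul1g eq_sym.
  rewrite big1 ?addr0 // => b gb; rewrite -(inj_eq (mulgI g^-1%g)) mulKg mulg1.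
  by rewrite (negPf gb) mul0r.
have invh : inverse_mat (fun b g => h (u * Gamma b g)) (fun g b => (g * b == 1)%g%:R).
  split; apply: matP => b c; rewrite mulmE /idm.
    by rewrite -sumT; apply: eq_bigr => g _; rewrite (u_resolventE _).2.
  by rewrite -sumT'; apply: eq_bigr => g _; rewrite (u_resolventE _).2.
have SuG b g : u * Gamma b g \in S by case: (u_resolventE (g * b)%g).
have skewF : GRing.field_axiom F by move=> x; rewrite unitfE.
have [N [uGN NuG]] := local_inverse skewU skewF Ssub hB hM hV SuG invh.
have Uu : u \is a GRing.unit := one_sub_lin_unit l.
exists (fun g b => N g b * u); split; apply: matP => b c; rewrite mulmE.
  rewrite -[LHS](mulKr Uu) mulr_sumr.
  under eq_bigr do rewrite !mulrA.
  rewrite -mulr_suml -[\sum_g _]/(mulm (fun b g => u * Gamma b g) N b c) uGN.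
  rewrite /idm; case: eqP => _; last by rewrite mul0r mulr0.
  by rewrite mul1r mulVr.
by rewrite -NuG; apply: eq_bigr => g _; rewrite mulrA.
Qed.

Definition Gamma_inv : G -> G -> U := sval (cid Gamma_inverse).

Lemma Gamma_mulV b c : \sum_g resolvent (g * b)%g * Gamma_inv g c = (b == c)%:R.
Proof. by have [/(congr1 (fun M => M b c))] := svalP (cid Gamma_inverse). Qed.

Lemma Gamma_mulVl g h : \sum_b Gamma_inv g b * resolvent (h * b)%g = (g == h)%:R.
Proof. by have [_ /(congr1 (fun M => M g h))] := svalP (cid Gamma_inverse). Qed.

(** If u = sum_b x_b p_b with invariant x_b, then act g u = sum_b x_b p_(gb) for all g. This is a
    linear system for the x_b with matrix [Gamma], solved here. *)
Definition coordinate (b : G) (u : U) : U := \sum_g act g u * Gamma_inv g b.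

Lemma coordinateP u g : \sum_b coordinate b u * resolvent (g * b)%g = act g u.
Proof.
rewrite /coordinate; under eq_bigr do rewrite mulr_suml.
rewrite exchange_big /=.
under eq_bigr do under eq_bigr do rewrite -mulrA.
under eq_bigr do rewrite -mulr_sumr Gamma_mulVl.
by rewrite sum_idr.
Qed.

Lemma coordinate_unique (x : G -> U) u : (forall g, \sum_b x b * resolvent (g * b)%g = act g u) ->
  forall b, x b = coordinate b u.
Proof.
move=> xu b; rewrite /coordinate; under eq_bigr do rewrite -xu mulr_suml.
rewrite exchange_big /=.
under eq_bigr do under eq_bigr do rewrite -mulrA.
under eq_bigr do rewrite -mulr_sumr Gamma_mulV.
by rewrite sum_idr.
Qed.

(** The images of the coordinates under [act h] solve the same system, whose solution is unique. *)
Lemma coordinate_fixed h b u : act h (coordinate b u) = coordinate b u.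
Proof.
apply: (@coordinate_unique (fun b => act h (coordinate b u))) => g.
transitivity (act h (\sum_b coordinate b u * resolvent (h^-1 * g * b)%g)).
  rewrite rmorph_sum; apply: eq_bigr => c _.
  by rewrite rmorphM /= act_resolvent !mulgA mulgV mul1g.
by rewrite coordinateP -actM mulgA mulgV mul1g.
Qed.

Lemma coordinate_shift b c u : coordinate c (act b^-1%g u) = coordinate (b * c)%g u.
Proof.
apply/esym; apply: (@coordinate_unique (fun c => coordinate (b * c)%g u)) => g.
rewrite -actM -coordinateP [RHS](reindex_inj (mulgI b)).
by apply: eq_bigr => d _; rewrite mulgA mulgKV.
Qed.

Lemma coordinate_resolvent b a : coordinate b (resolvent a) = (b == a)%:R.
Proof.
apply/esym; apply: (@coordinate_unique (fun b => (b == a)%:R)) => g.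
rewrite act_resolvent; under eq_bigr do rewrite eq_sym.
by rewrite (sum_idl (fun b => resolvent (g * b)%g)).
Qed.

Lemma coordinate_linear b r u v : coordinate b (r *: u + v) = r *: coordinate b u + coordinate b v.
Proof.
rewrite /coordinate scaler_sumr -big_split; apply: eq_bigr => g _.
by rewrite linearP mulrDl scalerAl.
Qed.

(** The parameters of the normal form as they occur in [U]: the invariants that the variables of [W]
    are going to replace. *)
Definition invariant_gen (s : option (G * 'I_n)) : U :=
  if s is Some (a, k) then coordinate 1%g (resolvent a * lin (rho a *m delta_mx (lift ord0 k) 0))
  else coordinate 1%g 1.

Lemma invariant_gen_coefficient a v :
  coefficient l invariant_gen a v = coordinate 1%g (resolvent a * lin (rho a *m v)).
Proof.
apply/esym; apply: (coefficient_unique l0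
  (f := fun v => coordinate 1%g (resolvent a * lin (rho a *m v)))) => //.
- move=> r u w; rewrite mulmxDr -scalemxAr linP mulrDr -scalerAr.
  exact: coordinate_linear.
have -> : resolvent a * lin (rho a *m l) = (-1) *: 1 + resolvent a.
  have := resolvent_mul a; rewrite mulrBr mulr1 => <-.
  by rewrite scaleN1r opprB subrK.
by rewrite coordinate_linear coordinate_resolvent eq_sym scaleN1r addrC.
Qed.

Lemma invariant_gen_normal_form v b c :
  normal_form rho l invariant_gen v b c = coordinate c (resolvent b * lin v).
Proof.
rewrite /normal_form invariant_gen_coefficient mulmxA -rhoM mulgK -act_resolvent -act_lin.
by rewrite -rmorphM coordinate_shift mulg1.
Qed.

(** At [g = 1] this says that the normal form is the matrix of right multiplication by [lin v] in
    the basis of resolvents; the other [g] give its translates, since the entries are invariant. *)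
Lemma resolvent_lin b v g :
  \sum_c normal_form rho l invariant_gen v b c * resolvent (g * c)%g =
  resolvent (g * b)%g * act g (lin v).
Proof.
under eq_bigr do rewrite invariant_gen_normal_form.
by rewrite coordinateP rmorphM /= act_resolvent.
Qed.

Variables (m : nat) (W : freeSkewField F m).
Variables (idx : 'I_m -> option (G * 'I_n)) (idx' : option (G * 'I_n) -> 'I_m).
Hypothesis idxK : cancel idx' idx.

Definition target_gen (s : option (G * 'I_n)) : W := gen W (idx' s).

Let yW (k : 'I_n.+1) := normal_form rho l target_gen (delta_mx k 0).
Let yU (k : 'I_n.+1) := normal_form rho l invariant_gen (delta_mx k 0).

(* The conjugate of the block diagonal matrix of the translates of [M]. *)
Definition conj_mat (I J : finType) (M : I -> J -> U) : I * G -> J * G -> U :=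
  fun x z => \sum_g resolvent (g * x.2)%g * act g (M x.1 z.1) * Gamma_inv g z.2.

Lemma conj_mat_mul (I J K : finType) (M : I -> J -> U) (N : J -> K -> U) :
  mulm (conj_mat M) (conj_mat N) = conj_mat (mulm M N).
Proof.
apply: matP => -[i b] [k c]; rewrite mulmE sum_prod /conj_mat /=.
under eq_bigr do under eq_bigr do rewrite big_distrlr /=.
under eq_bigr do rewrite exchange_big /=.
rewrite exchange_big /=; apply: eq_bigr => g _.
rewrite rmorph_sum mulr_sumr mulr_suml; apply: eq_bigr => j _.
rewrite exchange_big /= rmorphM /= !mulrA.
transitivity (\sum_h resolvent (g * b)%g * act g (M i j) *
    ((g == h)%:R * (act h (N j k) * Gamma_inv h c))).
  apply: eq_bigr => h _; rewrite -Gamma_mulVl mulr_suml mulr_sumr.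
  by apply: eq_bigr => d _; rewrite !mulrA.
by rewrite -mulr_sumr sum_idl !mulrA.
Qed.

Lemma conj_mat1 (I : finType) : conj_mat (@idm U I) = @idm U (I * G)%type.
Proof.
apply: matP => -[i b] [j c]; rewrite /conj_mat /idm xpair_eqE /=.
under eq_bigr do rewrite rmorph_nat.
case: (i == j) => /=; last by rewrite big1 // => g _; rewrite mulr0 mul0r.
by under eq_bigr do rewrite mulr1; rewrite Gamma_mulV.
Qed.

Lemma conj_mat_inverse (I : finType) (M N : I -> I -> U) : inverse_mat M N ->
  inverse_mat (conj_mat M) (conj_mat N).
Proof. by move=> [MN NM]; split; rewrite conj_mat_mul ?MN ?NM conj_mat1. Qed.

(** By [resolvent_lin], Phi(yU) times [Gamma] is [Gamma] times the diagonal of the translates of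
    Phi(x); then [Gamma] is inverted. *)
Lemma eval_conj (I J : finType) (Phi : pencil F n.+1 I J) :
  pencil_eval (GRing.in_alg U) (point yU) Phi = conj_mat (pencil_gen U Phi).
Proof.
apply: matP => -[i b] [j c].
have resolventE g :
    \sum_d pencil_eval (GRing.in_alg U) (point yU) Phi (i, b) (j, d) * resolvent (g * d)%g =
    resolvent (g * b)%g * act g (pencil_gen U Phi i j).
  rewrite /pencil_eval /pencil_gen rmorph_sum mulr_sumr.
  under eq_bigr do rewrite mulr_suml.
  rewrite exchange_big /=; apply: eq_bigr => o _.
  under eq_bigr do rewrite -mulrA.
  rewrite -mulr_sumr rmorphM /= linearZ /= rmorph1 mulr_algl mulr_algl -scalerAr.
  congr (_ *: _); case: o => [k|] /=; last first.
    by rewrite rmorph1 mulr1 (sum_idl (fun d => resolvent (g * d)%g)).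
  by rewrite /yU resolvent_lin lin_delta.
rewrite /conj_mat /=; under [RHS]eq_bigr do rewrite -resolventE mulr_suml.
rewrite exchange_big /=.
under [RHS]eq_bigr do under eq_bigr do rewrite -mulrA.
under [RHS]eq_bigr do rewrite -mulr_sumr Gamma_mulV.
by rewrite (sum_idr (fun d => pencil_eval (GRing.in_alg U) (point yU) Phi (i, b) (j, d))).
Qed.

Lemma in_alg_central (L : unitAlgType F) (r : F) : central (GRing.in_alg L r).
Proof. by move=> x; rewrite /= mulr_algl mulr_algr. Qed.

(** [W] specializes to [U] with its variables going to the invariants, and the pencil at [yW] goes
    to the one at [yU]. The latter is conjugate to the diagonal of translates of an invertible
    matrix, and invertibility lifts. *)
Lemma normal_form_generic (I : finType) (Phi : pencil F n.+1 I I) N :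
  inverse_mat (pencil_gen U Phi) N ->
  exists N', inverse_mat (pencil_eval (GRing.in_alg W) (point yW) Phi) N'.
Proof.
move=> /conj_mat_inverse; rewrite -eval_conj => invU.
have [S [h [[Ssub SF Sx] [hB hM] [hF hx] hV]]] :=
  universal_eval W (fun i => invariant_gen (idx i)) skewU (@in_alg_central U).
have [S1 SB SM] := Ssub.
have S0 : 0 \in S by rewrite -(subrr 1) SB.
have h0 : h 0 = 0 by rewrite -(subrr 1) hB ?subrr.
have h1 : h 1 = 1 by rewrite -[1]scale1r hF /= scale1r.
have hZ r x : x \in S -> r *: x \in S /\ h (r *: x) = r *: h x.
  by move=> Sx'; rewrite -mulr_algl SM // hM // hF /= mulr_algl.
have hb (e : bool) : e%:R \in S /\ h e%:R = e%:R by case: e.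
have hD x z : x \in S -> z \in S -> x + z \in S /\ h (x + z) = h x + h z.
  move=> Sx' Sz; have [SNz hNz] := hZ (-1) z Sz.
  rewrite -[z]opprK -[- z]scaleN1r SB // hB // hNz !scaleN1r !opprK //.
have hwgen s : target_gen s \in S /\ h (target_gen s) = invariant_gen s.
  by rewrite /target_gen Sx hx idxK.
have hcoef a v : coefficient l target_gen a v \in S /\
    h (coefficient l target_gen a v) = coefficient l invariant_gen a v.
  have [Sa ha] := hb (a == 1%g); have [Sn hn] := hwgen None.
  have [S2 h2] := hZ (v 0 0) _ (SB _ _ Sa Sn).
  have [|S3 h3] := @subring_morph_sum _ _ S h Ssub hB _
    (fun k => (v (lift ord0 k) 0 - v 0 0 * l (lift ord0 k) 0) *: target_gen (Some (a, k))).
    move=> k; set r := v _ _ - _.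
    by case: (hZ r _ (hwgen (Some (a, k))).1).
  rewrite /coefficient; have [S4 ->] := hD _ _ S2 S3; split=> //.
  rewrite h2 hB // ha hn h3; congr (_ + _); apply: eq_bigr => k _.
  by rewrite (hZ _ _ (hwgen _).1).2 (hwgen _).2.
have hpoint o b c : point yW o b c \in S /\ h (point yW o b c) = point yU o b c.
  by case: o => [k|]; [exact: hcoef|exact: hb].
have hev x z : pencil_eval (GRing.in_alg W) (point yW) Phi x z \in S /\
    h (pencil_eval (GRing.in_alg W) (point yW) Phi x z) =
    pencil_eval (GRing.in_alg U) (point yU) Phi x z.
  have [|S2 h2] := @subring_morph_sum _ _ S h Ssub hB _
    (fun o => GRing.in_alg W (Phi o x.1 z.1) * point yW o x.2 z.2).
    by move=> o; rewrite SM ?SF //; case: (hpoint o x.2 z.2).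
  split=> //; rewrite h2; apply: eq_bigr => o _.
  by have [So ho] := hpoint o x.2 z.2; rewrite hM ?SF // hF ho.
apply: (local_inverse (free_skew_field_skew W) skewU Ssub hB hM hV (N' := conj_mat N)).
  by move=> x z; case: (hev x z).
by rewrite (_ : (fun x z => _) = pencil_eval (GRing.in_alg U) (point yU) Phi) //;
  apply: matP => x z; case: (hev x z).
Qed.

Lemma target_gen_neq0 s : target_gen s != 0.
Proof.
have skewF : skew_field F by move=> x; rewrite unitfE.
have ioC (r : F) : central (@idfun F r) by move=> x; rewrite mulrC.
have [S [h [[Ssub SF Sx] [hB hM] [hF hx] hV]]] :=
  universal_eval W (io := idfun) (fun i => 1) skewF ioC.
have [S1 _ _] := Ssub.
apply/eqP => w0; have := hx (idx' s); rewrite -/(target_gen s) w0 -(subrr 1) hB // subrr.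
by move/esym/eqP; rewrite oner_eq0.
Qed.

(* The column sums of the matrix of an invariant element are all equal, since
   the matrix commutes with the permutation matrices of the group. *)
Theorem invariants_onto : (forall i, exists s, i = idx' s) -> exists om : U -> W,
  [/\ om 1 = 1,
      forall r u, om (r *: u) = r *: om u,
      forall u v, om (u - v) = om u - om v,
      forall u v, (forall g, act g u = u) -> om (u * v) = om u * om v
    & forall w, exists2 u, forall g, act g u = u & om u = w].
Proof.
move=> idx_onto.
have skewW := free_skew_field_skew W.
have [h [hF hx hB hM]] := matrix_hom skewW (@in_alg_central W) normal_form_generic.
have h0 : h 0 = fun _ _ => 0 by apply: matP => b c; rewrite -(subrr 1) hB subrr.
have h1 : h 1 = @idm W G.
  by apply: matP => b c; rewrite -[1]scale1r hF rmorph1 mul1r.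
have hZ r u : h (r *: u) = fun b c => r *: h u b c.
  apply: matP => b c; rewrite -mulr_algl hM hF mulmE.
  under eq_bigr do rewrite -mulrA.
  by rewrite -mulr_sumr sum_idl /= mulr_algl.
have hN u : h (- u) = fun b c => - h u b c.
  by apply: matP => b c; rewrite -sub0r hB h0 sub0r.
have hD u v : h (u + v) = fun b c => h u b c + h v b c.
  by apply: matP => b c; rewrite -{1}[v]opprK hB hN opprK.
have hlin v b c : h (lin v) b c = normal_form rho l target_gen v b c.
  apply: (@colvec_linear_ext _ _ _ (fun v => h (lin v) b c)
    (fun v => normal_form rho l target_gen v b c)) => [r u w|r u w|k].
  - by rewrite linP hD hZ.
  - exact: normal_formP.
  - by rewrite lin_delta hx.
(* Equivariance holds on the variables and is propagated to the skew field that they generate. *)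
have heq u g b c : h (act g u) b c = h u (g^-1 * b)%g (g^-1 * c)%g.
  pose S : {pred U} := [pred u | `[< forall g b c,
    h (act g u) b c = h u (g^-1 * b)%g (g^-1 * c)%g >]].
  suff: u \in S by move/asboolP.
  have inS v : v \in S -> forall g b c, h (act g v) b c = h v (g^-1 * b)%g (g^-1 * c)%g.
    by move/asboolP.
  have SM v w : v \in S -> w \in S -> v * w \in S.
    move=> /inS Sv /inS Sw; apply/asboolP => k d e; rewrite rmorphM !hM !mulmE.
    rewrite [RHS](reindex_inj (mulgI k^-1%g)).
    by apply: eq_bigr => f _; rewrite Sv Sw.
  have Sscal r : r%:A \in S.
    apply/asboolP => k d e; rewrite linearZ /= rmorph1 hF.
    by rewrite (inj_eq (mulgI _)).
  apply: free_skew_field_gen => // [|k]; last first.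
    apply/asboolP => k' d e; rewrite -lin_delta act_lin !hlin.
    exact: normal_form_equivariant.
  split=> [|v w /inS Sv /inS Sw|v w Sv Sw]; first by rewrite -[1]scale1r.
    by apply/asboolP => k d e; rewrite rmorphB !hB Sv Sw.
  have [->|w0] := eqVneq w 0; first by rewrite invr0 mulr0 -(scale0r (1 : U)).
  have Uw := skewU w0; apply: (SM) => //; apply/asboolP => k d e.
  (* [P] is the expected value at the inverse. It is a right inverse of [h (act k w)], of which
     [h (act k w^-1)] is a left inverse, so both agree. *)
  pose P d e := h w^-1 (k^-1 * d)%g (k^-1 * e)%g.
  have AP : mulm (h (act k w)) P = @idm W G.
    apply: matP => f f'; transitivity (h (w * w^-1) (k^-1 * f)%g (k^-1 * f')%g).
      rewrite hM !mulmE [RHS](reindex_inj (mulgI k^-1%g)).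
      by apply: eq_bigr => i _; rewrite (inS _ Sw).
    by rewrite mulrV // h1 /idm (inj_eq (mulgI _)).
  have AA : mulm (h (act k w^-1)) (h (act k w)) = @idm W G.
    by rewrite -hM -rmorphM mulVr // rmorph1 h1.
  by rewrite -[h (act k w^-1)]mulm1 -AP mulmA AA mul1m.
pose cs u d := \sum_f h u f d; pose om u := cs u 1%g.
have csE u : (forall g, act g u = u) -> forall d, cs u d = om u.
  move=> fu d; rewrite /cs /om /cs (reindex_inj (mulgI d)).
  by apply: eq_bigr => f _; rewrite -{1}(fu d) heq mulKg mulVg.
have csM u v d : cs (u * v) d = \sum_e cs u e * h v e d.
  rewrite /cs; under eq_bigr do rewrite hM mulmE.
  by rewrite exchange_big; apply: eq_bigr => e _; rewrite mulr_suml.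
have csB u v d : cs (u - v) d = cs u d - cs v d.
  by rewrite /cs -sumrB; apply: eq_bigr => f _; rewrite hB.
have cs0 d : cs 0 d = 0 by rewrite -(subrr 1) csB subrr.
have csD u v d : cs (u + v) d = cs u d + cs v d.
  by rewrite -{1}[v]opprK csB -sub0r csB cs0 sub0r opprK.
have csZ r u d : cs (r *: u) d = r *: cs u d.
  by rewrite /cs scaler_sumr; apply: eq_bigr => f _; rewrite hZ.
(* The row of column sums of an invariant [u] is constant, so it factors out. *)
have omM u v : (forall g, act g u = u) -> om (u * v) = om u * om v.
  move=> fu; rewrite {1}/om csM; under eq_bigr do rewrite csE //.
  by rewrite -mulr_sumr.
have om1 : om 1 = 1.
  by rewrite /om /cs h1 /idm (bigD1 1%g) //= eqxx big1 ?addr0 // => g /negPf ->.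
pose w0 := target_gen None; have Uw0 := skewW _ (target_gen_neq0 None); rewrite -/w0 in Uw0.
(* By the value of the normal form at [l], row [b] of the matrix of 1 - l_b is constant equal to
   [w0]. Its product with the matrix of [resolvent b] must be row [b] of the identity. *)
have cs_resolvent b d : cs (resolvent b) d = w0^-1 * (b == d)%:R.
  rewrite -[cs _ _](mulKr Uw0); congr (_ * _).
  have := congr1 (fun M => M b d) (hM (1 - lin (rho b *m l)) (resolvent b)).
  rewrite {1}/resolvent mulrV ?one_sub_lin_unit // h1 => E.
  rewrite -[RHS]/(@idm W G b d) E mulmE mulr_sumr.
  apply: eq_bigr => c _; congr (_ * _); rewrite hB h1 hlin /normal_form.
  rewrite mulmxA -rhoM mulVg rho1 mul1mx coefficient_l // -(inj_eq (mulgI c)) mulKVg mulg1.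
  by rewrite /idm opprB addrC subrK.
have fix_nf v b d g :
    act g (normal_form rho l invariant_gen v b d) = normal_form rho l invariant_gen v b d.
  by rewrite invariant_gen_normal_form coordinate_fixed.
(* Column sums of [resolvent_lin] at [g = 1]: on these invariants [om] takes the corresponding
   entries over [W], conjugated by [w0]. *)
have key v b d : om (normal_form rho l invariant_gen v b d) =
    w0^-1 * normal_form rho l target_gen v b d * w0.
  have /(congr1 (fun u => cs u d)) := resolvent_lin b v 1%g.
  rewrite mul1g act1 csM (big_morph (fun u => cs u d) (fun x z => csD x z d) (cs0 d)) => E.
  have {E} : om (normal_form rho l invariant_gen v b d) * w0^-1 =
       w0^-1 * normal_form rho l target_gen v b d.
    transitivity (\sum_e cs (resolvent b) e * h (lin v) e d); last first.
      under eq_bigr do rewrite cs_resolvent hlin -mulrA.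
      by rewrite -mulr_sumr sum_idl.
    rewrite -E.
    transitivity (\sum_c om (normal_form rho l invariant_gen v b c) * w0^-1 * (c == d)%:R).
      by rewrite sum_idr.
    apply: eq_bigr => c _; rewrite mul1g csM -mulrA -cs_resolvent /cs mulr_sumr.
    by apply: eq_bigr => e _; rewrite -/(cs _ e) csE.
  by move/(congr1 (fun x => x * w0)); rewrite mulrVK.
exists om; split=> // [r u|u v|w].
- exact: csZ.
- exact: csB.
pose S : {pred W} := [pred w | `[< exists2 u, forall g, act g u = u & om u = w >]].
suff: w \in S by move/asboolP.
have inS x : x \in S -> exists2 u, forall g, act g u = u & om u = x by move/asboolP.
have Sscal r : r%:A \in S.
  by apply/asboolP; exists r%:A => [g|]; [rewrite linearZ /= rmorph1|rewrite /om csZ -/(om _) om1].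
have SM : {in S &, forall x z, x * z \in S}.
  move=> _ _ /inS[u fu <-] /inS[v fv <-]; apply/asboolP; exists (u * v); last exact: omM.
  by move=> g; rewrite rmorphM /= fu fv.
have SB : {in S &, forall x z, x - z \in S}.
  move=> _ _ /inS[u fu <-] /inS[v fv <-]; apply/asboolP; exists (u - v); last exact: csB.
  by move=> g; rewrite rmorphB /= fu fv.
have SV x : x \in S -> x^-1 \in S.
  case/inS => u fu <-; have [->|u0] := eqVneq u 0.
    by rewrite /om cs0 invr0 -(scale0r (1 : W)).
  have Uu := skewU u0; have ouV : om u * om u^-1 = 1 by rewrite -omM // mulrV.
  have Uom : om u \is a GRing.unit.
    by apply: skewW; apply/eqP => E; move/eqP: ouV; rewrite E mul0r eq_sym oner_eq0.
  apply/asboolP; exists u^-1; last by rewrite -[om u^-1](mulKr Uom) ouV mulr1.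
  by move=> g; rewrite rmorphV //= fu.
have S1 : 1 \in S by rewrite -[1]scale1r.
have Skey v b d : w0^-1 * normal_form rho l target_gen v b d * w0 \in S.
  by rewrite -key; apply/asboolP; exists (normal_form rho l invariant_gen v b d) => // g;
    exact: fix_nf.
(* At [v = l] and [b = d = 1] the normal form is [1 - w0], which conjugation by [w0] fixes. Once
   [w0] is in the image, the conjugation can be undone. *)
have Sw0 : w0 \in S.
  have := Skey l 1%g 1%g; rewrite /normal_form invg1 mulg1 rho1 mul1mx coefficient_l // eqxx.
  rewrite -/w0 mulrBr mulr1 mulVr // mulrBl mul1r mulVr // => /(SB _ _ S1).
  by rewrite subKr.
have Snf v b d : normal_form rho l target_gen v b d \in S.
  have := SM _ _ (SM _ _ Sw0 (Skey v b d)) (SV _ Sw0).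
  by rewrite !mulrA mulrV // mul1r mulrK.
apply: free_skew_field_gen => // [|i].
  by split=> // x z Sx Sz; rewrite SM ?SV.
have [[[a k]|] ->] := idx_onto i; last exact: Sw0.
(* For v = a e_k and the entry at [a], 1 the normal form reduces to the single parameter
   [Some (a, k)]. *)
have := Snf (rho a *m delta_mx (lift ord0 k) 0) a 1%g.
by rewrite /normal_form mulmxA -rhoM mulVg rho1 mul1mx invg1 mul1g coefficient_delta.
Qed.

End GroupAction.

(** * From the column sum to an isomorphism of algebras *)

Section AlgMorphism.

Variables (F : fieldType) (A B : unitAlgType F) (f : A -> B).
Hypothesis fB : zmod_morphism f.
Hypothesis fM : monoid_morphism f.
Hypothesis fZ : scalable f.

(** The proofs are arguments so that the morphism structures can be attached to an arbitrary
    function. *)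
Definition alg_morphism (_ : zmod_morphism f) (_ : monoid_morphism f)
  (_ : scalable f) : A -> B := f.

HB.instance Definition _ := GRing.isZmodMorphism.Build A B (alg_morphism fB fM fZ) fB.
HB.instance Definition _ := GRing.isMonoidMorphism.Build A B (alg_morphism fB fM fZ) fM.
HB.instance Definition _ := GRing.isScalable.Build F A B *:%R (alg_morphism fB fM fZ) fZ.

Lemma alg_isomorphicI : injective f -> (forall b, exists a, f a = b) -> alg_isomorphic A B.
Proof.
move=> f_inj f_onto; exists (alg_morphism fB fM fZ : {lrmorphism A -> B}).
have [g fg] := choice f_onto; exists g => // a.
by apply: f_inj; rewrite fg.
Qed.

End AlgMorphism.

Section FixedField.

Variables (F : fieldType) (gT : finGroupType) (A : {group gT}).
Variables (U W : unitAlgType F) (act : gT -> {lrmorphism U -> U}).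
Hypothesis skewU : skew_field U.
Variable om : U -> W.
Hypothesis om1 : om 1 = 1.
Hypothesis omZ : forall r u, om (r *: u) = r *: om u.
Hypothesis omB : forall u v, om (u - v) = om u - om v.
Hypothesis omM : forall u v, {in A, forall g, act g u = u} -> om (u * v) = om u * om v.
Hypothesis om_onto : forall w, exists2 u, {in A, forall g, act g u = u} & om u = w.

Lemma fixed_field_isomorphic : alg_isomorphic (fixed_field A act) W.
Proof.
pose f (x : fixed_field A act) : W := om (val x).
have fixP (x : fixed_field A act) : {in A, forall g, act g (val x) = val x}.
  exact/fixed_predP/valP.
have fB : zmod_morphism f by move=> x z; rewrite /f rmorphB omB.
have fM : monoid_morphism f.
  split=> [|x z]; first by rewrite /f rmorph1.
  by rewrite /f rmorphM omM //; exact: fixP.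
have fZ : scalable f by move=> r x; rewrite /f linearZ omZ.
apply: (alg_isomorphicI fB fM fZ).
(* A nonzero difference of invariants is invertible, so its image under [om] cannot be 0. *)
- move=> x z fxz; apply/val_inj/eqP; rewrite -subr_eq0; apply/negPn/negP => xz.
  have Uxz := skewU xz.
  have : om (val x - val z) * om (val x - val z)^-1 = 1.
    rewrite -omM ?mulrV // => g gA.
    by rewrite rmorphB /= !fixP.
  by rewrite omB (fxz : om (val x) = om (val z)) subrr mul0r => /esym/eqP; rewrite oner_eq0.
- move=> w; have [u fu <-] := om_onto w.
  by exists (exist _ u (introT (fixed_predP _ _ _) fu)).
Qed.

End FixedField.

Lemma free_skew_field0 (F : fieldType) (U : freeSkewField F 0) (u : U) :
  exists r : F, u = r%:A.
Proof.
pose S : {pred U} := [pred u | `[< exists r : F, u = r%:A >]].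
suff: u \in S by move/asboolP.
have inS v : v \in S -> exists r : F, v = r%:A by move/asboolP.
apply: free_skew_field_gen => [|r|[]//]; last by apply/asboolP; exists r.
split=> [|v w /inS[r ->] /inS[s ->]|v w /inS[r ->] /inS[s ->]]; apply/asboolP.
- by exists 1; rewrite scale1r.
- by exists (r - s); rewrite scalerBl.
- exists (r / s); rewrite -[r%:A]/(GRing.in_alg U r) -[s%:A]/(GRing.in_alg U s).
  by rewrite -fmorphV -rmorphM.
Qed.

Theorem theorem3p5 (R : realType) (n m : nat)
    (gT : finGroupType) (A : {group gT})
    (U : freeSkewField R n) (W : freeSkewField R m)
    (act : gT -> {lrmorphism U -> U}) :
  abelian A ->
  algebra_action A act ->
  linear_action A act ->
  faithful_action A act ->
  m%:Z = #|A|%:Z * (n%:Z - 1) + 1 ->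
  alg_isomorphic (fixed_field A act) W.
Proof.
move=> _ [act1 actM] [rho rhoE] faith mE.
case: n => [|n] in U act act1 actM rho rhoE faith mE *.
  (* Here m = 1 - |A| is nonnegative and |A| positive, so m is 0 and both skew fields consist of
     scalars. *)
  have m0 : m = 0%N by have := cardG_gt0 A; lia.
  move: W; rewrite m0 => W.
  have [c cP] := choice (@free_skew_field0 _ U).
  have cU r : c r%:A = r.
    by apply: (fmorph_inj (GRing.in_alg U)); rewrite /= -cP.
  apply: (@fixed_field_isomorphic _ _ A U W act (free_skew_field_skew U) (fun u => (c u)%:A)).
  - by rewrite -[X in c X](scale1r (1 : U)) cU scale1r.
  - by move=> r u; rewrite {1}(cP u) scalerA cU scalerA.
  - by move=> u v; rewrite {1}(cP u) {1}(cP v) -scalerBl cU scalerBl.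
  - move=> u v _; rewrite {1}(cP u) {1}(cP v) mulr_algl scalerA cU.
    by rewrite mulr_algl scalerA.
  - move=> w; have [r ->] := free_skew_field0 w; exists r%:A; last by rewrite cU.
    by move=> g _; rewrite linearZ rmorph1.
(* [A] becomes a group type of its own, so that the laws of the action and of the representation
   hold for all its elements. *)
pose G := subg_of A; pose al (g : G) := act (sgval g); pose rh (g : G) := rho (sgval g).
have al1 : al 1%g =1 id by exact: act1.
have alM (g h : G) u : al (g * h)%g u = al g (al h u).
  exact: actM (valP g) (valP h) u.
have al_gen (g : G) j : al g (gen U j) = \sum_i rh g i j *: gen U i by apply: rhoE (valP g) j.
have rh1 : rh 1%g = 1%:M by exact: repr_mx1.
have rhM (g h : G) : rh (g * h)%g = rh g *m rh h by apply: repr_mxM; exact: valP.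
(* The elements of [U] fixed by [g] form a division-closed set, so trivial action on the variables
   means trivial action on [U]. *)
have rh_inj (g : G) : rh g = 1%:M -> g = 1%g.
  move=> rg; apply/val_inj/faith; first exact: valP.
  move=> u; pose S : {pred U} := [pred u | al g u == u].
  suff: u \in S by move/eqP.
  apply: free_skew_field_gen => [|r|j]; last 2 first.
  - by rewrite inE linearZ rmorph1.
  - rewrite inE al_gen rg (bigD1 j) //= mxE eqxx scale1r big1 ?addr0 // => i /negPf ij.
    by rewrite mxE ij scale0r.
  split=> [|v w /eqP Sv /eqP Sw|v w /eqP Sv /eqP Sw]; rewrite inE.
  - by rewrite rmorph1.
  - by rewrite rmorphB /= Sv Sw.
  - have [->|w0] := eqVneq w 0; first by rewrite invr0 mulr0 rmorph0.
    by rewrite rmorphM /= rmorphV ?(free_skew_field_skew U) //= Sv Sw.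
have [l [l0 lP]] := generic_vector rh_inj.
have [p [pl pP]] := generic_functional l0 lP.
(* [U] now has [n.+1] variables, and [n] of them remain besides [l]: the number of parameters is |G|
   n + 1 = m. *)
have card_idx : #|{: option (G * 'I_n)}| = m.
  rewrite card_option card_prod card_ord card_sub; have -> : #|[pred x in A]| = #|A| by [].
  lia.
pose idx' s : 'I_m := cast_ord card_idx (enum_rank s).
pose idx i : option (G * 'I_n) := enum_val (cast_ord (esym card_idx) i).
have idxK : cancel idx' idx by move=> s; rewrite /idx /idx' cast_ordK enum_rankK.
have idx_onto i : exists s, i = idx' s.
  by exists (idx i); rewrite /idx /idx' enum_valK cast_ordKV.
have [om [om1 omZ omB omM om_onto]] :=
  invariants_onto al1 alM al_gen rh1 rhM l0 pl pP W idxK idx_onto.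
apply: (@fixed_field_isomorphic _ _ A U W act (free_skew_field_skew U) om) => //.
- by move=> u v fu; apply: omM => g; exact: fu (valP g).
- move=> w; have [u fu uw] := om_onto w; exists u => // g gA.
  exact: fu (Subg gA).
Qed.
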